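(* Let $F$ be a field of characteristic $2$. Let $\phi$ be an anisotropic quadratic form over $F$ of type $(1,3)$, and let $\tau=a[1,b]\perp\langle1\rangle$ be an anisotropic quadratic form over $F$ of dimension $3$ and type $(1,1)$. Then $\phi$ is $F(\tau)$-minimal if and only if the following three conditions are satisfied: (i) $\phi$ is a Pfister neighbor of a $3$-fold quadratic Pfister form $\pi$; (ii) $\pi\simeq\langle\langle c,a,b]]$ for some $c\in F^*$; (iii) for any $e\in F^*$, if $e[1,b]\subset\phi$ then $e\notin D_F(a[1,b])\cdot D_F(\mathrm{ql}(\phi))$.
   Context: $F$ is a field of characteristic $2$, $F^*=F\setminus\{0\}$. $[a,b]$ denotes the binary quadratic form $ax^2+xy+by^2$, $\langle c\rangle$ the form $cz^2$, $\langle c_1,\dots,c_s\rangle=\langle c_1\rangle\perp\cdots\perp\langle c_s\rangle$; $\perp$ is orthogonal sum and $\simeq$ isometry. Every quadratic form is isometric to some $[a_1,b_1]\perp\cdots\perp[a_r,b_r]\perp\langle c_1,\dots,c_s\rangle$; it is then said to be of type $(r,s)$. The form $\langle c_1,\dots,c_s\rangle$ is unique up to isometry, is called the quasilinear part of the form $\phi$ and is denoted $\mathrm{ql}(\phi)$. $D_F(\phi)$ is the set of elements of $F^*$ represented by $\phi$; for $A,B\subseteq F^*$, $A\cdot B=\{xy\mid x\in A,\ y\in B\}$. Domination: $(V,\phi)$ is dominated by $(W,\psi)$, written $\phi\prec\psi$, if there is an injective $F$-linear map $\sigma:V\to W$ with $\phi(v)=\psi(\sigma(v))$ for all $v\in V$.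 Subform: $\phi\subset\psi$ means $\psi\simeq\phi\perp\phi'$ for some quadratic form $\phi'$. Minimality: for a field extension $K/F$, an anisotropic form $\phi$ over $F$ is $K$-minimal if $\phi_K$ is isotropic and every form $\psi$ over $F$ dominated by $\phi$ with $\dim\psi<\dim\phi$ remains anisotropic over $K$. Function field: $F(\tau)$ is the quotient field of $F[x,y,z]/(P_\tau)$, where $P_\tau=a(x^2+xy+by^2)+z^2$. Pfister forms: $\langle a_1,\dots,a_n\rangle_b$ is the diagonal symmetric bilinear form $\sum a_ix_iy_i$; $\langle\langle a_1,\dots,a_n\rangle\rangle_b=\langle1,a_1\rangle_b\otimes\cdots\otimes\langle1,a_n\rangle_b$ ($a_i\in F^*$) is an $n$-fold bilinear Pfister form; $\langle\langle a_1,\dots,a_{m-1},c]]=\langle\langle a_1,\dots,a_{m-1}\rangle\rangle_b\cdot[1,c]$ is an $m$-fold quadratic Pfister form (here $\langle d_1,\dots,d_k\rangle_b\cdot q= d_1q\perp\cdots\perp d_kq$ for a nonsingular quadratic form $q$). A quadratic form $\phi$ is a Pfister neighbor of a quadratic Pfister form $\pi$ if $\alpha\phi\prec\pi$ for some $\alpha\in F^*$ and $2\dim\phi>\dim\pi$. *)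

(* Defs.v *)
From HB Require Import structures.
From mathcomp Require Import all_boot all_order all_algebra.
From mathcomp Require Import ring.
From mathcomp Require Import mpoly.

Set Implicit Arguments.
Unset Strict Implicit.
Unset Printing Implicit Defensive.

Import GRing.Theory.
Local Open Scope ring_scope.

Section QuadraticForms.
Variable F : fieldType.

Definition polar (V : lmodType F) (q : V -> F) (v w : V) : F :=
  q (v + w) - q v - q w.

(* Linearity in the first argument suffices, since [polar q] is symmetric. *)
Definition quadratic (V : lmodType F) (q : V -> F) : Prop :=
  (forall c v, q (c *: v) = c ^+ 2 * q v) /\
  (forall w, scalar (fun v => polar q v w)).

Record qform := QForm {
  qspace : vectType F;
  qval :> qspace -> F;
  qvalP : quadratic qval
}.

Definition qdim (phi : qform) : nat := \dim {: qspace phi}.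

Definition isotropic (phi : qform) : Prop :=
  exists v : qspace phi, v != 0 /\ phi v = 0.

Definition anisotropic (phi : qform) : Prop := ~ isotropic phi.

Definition represents (phi : qform) (c : F) : Prop :=
  c != 0 /\ exists v : qspace phi, phi v = c.

Definition dominated (phi psi : qform) : Prop :=
  exists f : {linear qspace phi -> qspace psi},
    injective f /\ forall v, phi v = psi (f v).

Definition isometric (phi psi : qform) : Prop :=
  exists f : {linear qspace phi -> qspace psi},
    bijective f /\ forall v, phi v = psi (f v).

Lemma quadratic0 (V : lmodType F) : quadratic (fun _ : V => 0).
Proof. by split=> [c v|w a u v]; rewrite /polar ?subr0 ?mulr0 ?addr0. Qed.

Lemma quadraticD (V : lmodType F) (p q : V -> F) :
  quadratic p -> quadratic q -> quadratic (fun v => p v + q v).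
Proof.
move=> [pZ pB] [qZ qB]; split=> [c v|w a u v]; first by rewrite pZ qZ mulrDr.
have polarD x y : polar (fun v => p v + q v) x y = polar p x y + polar q x y.
  by rewrite /polar; ring.
by rewrite !polarD pB qB; ring.
Qed.

Lemma quadratic_sum (V : lmodType F) (I : Type) (r : seq I) (P : pred I)
    (q : I -> V -> F) :
  (forall i, quadratic (q i)) -> quadratic (fun v => \sum_(i <- r | P i) q i v).
Proof.
move=> qP; elim: r => [|i r IH].
  have [h1 h2] := quadratic0 V.
  split=> [c v|w a u v]; rewrite /polar !big_nil; first exact: h1.
  exact: (h2 w a u v).
case: (boolP (P i)) => Pi.
  have [h1 h2] := quadraticD (qP i) IH.
  split=> [c v|w a u v]; rewrite /polar !big_cons Pi; first exact: h1.
  exact: (h2 w a u v).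
have [h1 h2] := IH.
split=> [c v|w a u v]; rewrite /polar !big_cons (negPf Pi); first exact: h1.
exact: (h2 w a u v).
Qed.

Lemma quadraticM (V : lmodType F) (k : F) (l m : V -> F) :
  scalar l -> scalar m -> quadratic (fun v => k * (l v * m v)).
Proof.
move=> lP mP.
have l0 : l 0 = 0 by have := lP (-1) 0 0; rewrite scaler0 addr0 mulN1r addNr.
have m0 : m 0 = 0 by have := mP (-1) 0 0; rewrite scaler0 addr0 mulN1r addNr.
have lD u v : l (u + v) = l u + l v by rewrite -[u]scale1r lP mul1r scale1r.
have mD u v : m (u + v) = m u + m v by rewrite -[u]scale1r mP mul1r scale1r.
split=> [c v|w a u v].
  by rewrite -[c *: v]addr0 lP mP l0 m0 !addr0; ring.
by rewrite /polar !lD !mD -[a *: u]addr0 lP mP l0 m0 !addr0; ring.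
Qed.

Lemma q1_subproof (c : F) : quadratic (fun z : F^o => c * (z * z)).
Proof. exact: (@quadraticM F^o c id id). Qed.
Definition q1 (c : F) : qform := QForm (q1_subproof c).

Lemma q2_subproof (a b : F) : quadratic (fun v : F^o * F^o =>
  a * v.1 ^+ 2 + v.1 * v.2 + b * v.2 ^+ 2).
Proof.
by split=> [c [x y]|[x y] c [x1 y1] [x2 y2]]; rewrite /polar /= /GRing.scale /=;
  ring.
Qed.
Definition q2 (a b : F) : qform := QForm (q2_subproof a b).

Lemma q0_subproof : quadratic (fun _ : 'rV[F]_0 => 0).
Proof. exact: quadratic0. Qed.
Definition q0 : qform := QForm q0_subproof.

Lemma qorth_subproof (phi psi : qform) :
  quadratic (fun v : qspace phi * qspace psi => phi v.1 + psi v.2).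
Proof.
case: phi psi => [V p [pZ pB]] [W q [qZ qB]] /=.
split=> [c v|w a u v] /=; first by rewrite pZ qZ mulrDr.
have polarE x y : polar (fun v : V * W => p v.1 + q v.2) x y =
    polar p x.1 y.1 + polar q x.2 y.2 by rewrite /polar /=; ring.
by rewrite !polarE /= pB qB; ring.
Qed.
Definition qorth (phi psi : qform) : qform := QForm (qorth_subproof phi psi).

Lemma qscale_subproof (c : F) (phi : qform) :
  quadratic (fun v : qspace phi => c * phi v).
Proof.
case: phi => [V p [pZ pB]] /=; split=> [d v|w a u v]; first by rewrite pZ; ring.
have polarE x y : polar (fun v => c * p v) x y = c * polar p x y.
  by rewrite /polar; ring.
by rewrite !polarE pB; ring.
Qed.
Definition qscale (c : F) (phi : qform) : qform :=
  QForm (qscale_subproof c phi).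

Definition qsum (s : seq qform) : qform := foldr qorth q0 s.

Definition qdiag (cs : seq F) : qform := qsum [seq q1 c | c <- cs].

Definition qbin (abs : seq (F * F)) : qform :=
  qsum [seq q2 ab.1 ab.2 | ab <- abs].

Definition subform (phi psi : qform) : Prop :=
  exists phi' : qform, isometric psi (qorth phi phi').

Definition of_type (r s : nat) (phi : qform) : Prop :=
  exists (abs : r.-tuple (F * F)) (cs : s.-tuple F),
    isometric phi (qorth (qbin abs) (qdiag cs)).

(* The quasilinear part is unique only up to isometry, hence a relation. *)
Definition is_ql (phi rho : qform) : Prop :=
  exists (abs : seq (F * F)) (cs : seq F),
    isometric phi (qorth (qbin abs) (qdiag cs)) /\ isometric rho (qdiag cs).

(* A diagonal symmetric bilinear form is encoded by the list of its diagonal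
   coefficients. *)
Definition btensor (ds es : seq F) : seq F := [seq d * e | d <- ds, e <- es].

Definition bpfister (s : seq F) : seq F :=
  foldr (fun a ds => btensor [:: 1; a] ds) [:: 1] s.

Definition bmulq (ds : seq F) (q : qform) : qform :=
  qsum [seq qscale d q | d <- ds].

(* <<a_1, ..., a_(m-1), c]] with s = [:: a_1; ...; a_(m-1)] *)
Definition qpfister (s : seq F) (c : F) : qform := bmulq (bpfister s) (q2 1 c).

Definition is_qpfister (m : nat) (pi : qform) : Prop :=
  exists (s : seq F) (c : F),
    [/\ (size s).+1 = m, all (fun a => a != 0) s & isometric pi (qpfister s c)].

Definition pfister_neighbor (phi pi : qform) : Prop :=
  (exists alpha : F, alpha != 0 /\ dominated (qscale alpha phi) pi) /\
  (qdim pi < 2 * qdim phi)%N.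

Definition prodset (A B : F -> Prop) (z : F) : Prop :=
  exists x y, [/\ A x, B y & z = x * y].

End QuadraticForms.

Section ScalarExtension.
Variables (F K : fieldType) (iota : {rmorphism F -> K}).

(* phi_K, with K (x) V identified with K^n through a basis of V; expanding by the
   polar form over i < j is what makes this correct in characteristic 2. *)
Definition qext_val (phi : qform F) (x : 'rV[K]_(qdim phi)) : K :=
  let e := vbasis {: qspace phi} in
  \sum_(i < qdim phi) iota (phi e`_i) * (x 0 i * x 0 i) +
  \sum_(i < qdim phi) \sum_(j < qdim phi | (i < j)%N)
    iota (polar phi e`_i e`_j) * (x 0 i * x 0 j).

Lemma qext_subproof (phi : qform F) : quadratic (@qext_val phi).
Proof.
have cP n (i : 'I_n) : scalar (fun x : 'rV[K]_n => x 0 i).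
  by move=> c u v; rewrite !mxE.
apply: quadraticD; apply: quadratic_sum => i.
  exact: (quadraticM _ (cP _ i) (cP _ i)).
by apply: quadratic_sum => j; exact: (quadraticM _ (cP _ i) (cP _ j)).
Qed.
Definition qext (phi : qform F) : qform K := QForm (@qext_subproof phi).

Definition minimal (phi : qform F) : Prop :=
  [/\ anisotropic phi,
      isotropic (qext phi) &
      forall psi : qform F,
        dominated psi phi -> (qdim psi < qdim phi)%N -> anisotropic (qext psi)].

End ScalarExtension.

Section FunctionField.
Variable F : fieldType.

Definition tau_form (a b : F) : qform F := qorth (qscale a (q2 1 b)) (q1 1).

Definition tau_poly (a b : F) : {mpoly F[3]} :=
  let x : {mpoly F[3]} := 'X_(inord 0) in
  let y : {mpoly F[3]} := 'X_(inord 1) in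
  let z : {mpoly F[3]} := 'X_(inord 2) in
  a%:MP * (x ^+ 2 + x * y + b%:MP * y ^+ 2) + z ^+ 2.

(* K, as an extension of F through iota, is a quotient field of
   F[X_0, ..., X_(n-1)] / (P); ev is the canonical map from the polynomial ring. *)
Definition is_quotient_field (n : nat) (P : {mpoly F[n]}) (K : fieldType)
    (iota : {rmorphism F -> K}) : Prop :=
  exists ev : {rmorphism {mpoly F[n]} -> K},
    [/\ forall c : F, ev c%:MP = iota c,
        forall p, ev p = 0 <-> exists q, p = q * P &
        forall k : K, exists p q, ev q != 0 /\ k = ev p / ev q].

End FunctionField.

(* Main.v *)
Require Import Defs.
From HB Require Import structures.
From mathcomp Require Import all_boot all_order all_algebra.
From mathcomp Require Import ring zify.
From mathcomp Require Import mpoly.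
From Stdlib Require Import Classical_Prop.
Set Implicit Arguments.
Unset Strict Implicit.
Unset Printing Implicit Defensive.
Import GRing.Theory.
Local Open Scope ring_scope.

(** Put N(x, y) = x^2 + xy + by^2, so that tau = 0 is the conic aN(x, y) + z^2 = 0,
    and let K = F(tau).  Everything turns on one alternative: an anisotropic phi of
    dimension at most 5 that becomes isotropic over K either dominates a multiple
    l tau, or has dimension 5, and then, if its polar form has rank 2, a multiple of
    it is dominated by a Pfister form <<s, a, b]].

    The alternative is proved by descent on the conic, in the manner of
    Cassels-Pfister and Rost.  Let A = F[x, z], z^2 = -a(x^2 + x + b), be the affine
    ring of the conic; the elements of degree at most n (pole order at infinity) form
    a space of dimension 2n+1.  An isotropic vector over K can be moved to A
    (isotropic_over_ring).  Take one of minimal degree n.  If its coordinates span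
    less than the whole space of elements of degree at most n, a reflection lowers n
    (descent); hence 2n+1 <= dim phi <= 5, so n is 1 or 2, as n = 0 would be an
    isotropic vector over F.  For n = 1, comparing coefficients shows that the three
    coefficient vectors span a copy of l tau (conic_vectors).  For n = 2, the five
    coefficient vectors are a basis in which phi satisfies nine linear relations
    (mquad_row2).  If the polar form has rank 2 its Pfaffians vanish, and together
    with anisotropy this leaves a three-parameter normal form (degree2_normal_form)
    which can be embedded explicitly (degree2_pfister).

    The theorem follows.  The form l tau is isotropic over K and has dimension 3, so
    a minimal phi dominates none, and the second branch gives the Pfister form.
    Conversely <<c, a, b]] vanishes on a 4-dimensional subspace over K, which every
    5-dimensional dominated form must meet (pfister_ext_isotropic); and a form of
    dimension at most 4 can only fall into the first branch, so any proper dominated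
    form that is isotropic over K dominates some l tau.  Finally phi dominates some
    l tau exactly when some e[1, b] splits off phi with e in D(a[1, b]) D(ql phi),
    because the orthogonal complement of a nonsingular plane in phi is its radical
    and N is multiplicative (conic_vectors_subform, subform_conic_vectors). *)

(** * Quadratic extensions of a ring *)

(** Elements p + q z of R[z] with z^2 = h, as pairs (p, q). *)
Definition quad (R : comNzRingType) (h : R) : Type := (R * R)%type.

(** The product is sealed so that unification never unfolds it. *)
HB.lock Definition quad_mul (R : comNzRingType) (h : R) (f g : quad h) : quad h :=
  (f.1 * g.1 + h * (f.2 * g.2), f.1 * g.2 + f.2 * g.1).
Canonical quad_mul_unlockable := Unlockable quad_mul.unlock.

Section QuadRing.
Variables (R : comNzRingType) (h : R).
HB.instance Definition _ := GRing.Zmodule.copy (quad h) (R * R)%type.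
Local Notation quad_mul := (@quad_mul R h).

Fact quad_mulA : associative quad_mul.
Proof. by move=> [a b] [c d] [e f]; rewrite ?unlock; congr pair; rewrite /=; ring. Qed.
Fact quad_mulC : commutative quad_mul.
Proof. by move=> [a b] [c d]; rewrite ?unlock; congr pair; rewrite /=; ring. Qed.
Fact quad_mul1 : left_id ((1, 0) : quad h) quad_mul.
Proof. by move=> [a b]; rewrite ?unlock; congr pair; rewrite /=; ring. Qed.
Fact quad_mulD : left_distributive quad_mul +%R.
Proof. by move=> [a b] [c d] [e f]; rewrite ?unlock; congr pair; rewrite /=; ring. Qed.
Fact quad_1neq0 : ((1, 0) : quad h) != 0.
Proof. by apply/eqP; case=> /eqP; rewrite oner_eq0. Qed.
HB.instance Definition _ := GRing.Zmodule_isComNzRing.Build (quad h)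
  quad_mulA quad_mulC quad_mul1 quad_mulD quad_1neq0.

Lemma quad_mulE (f g : quad h) :
  f * g = (f.1 * g.1 + h * (f.2 * g.2), f.1 * g.2 + f.2 * g.1).
Proof. by rewrite /GRing.mul /= unlock. Qed.

Definition quadC (c : R) : quad h := (c, 0).
Fact quadC_zmod : zmod_morphism quadC.
Proof. by move=> c d; congr pair; rewrite /= subr0. Qed.
Fact quadC_monoid : monoid_morphism quadC.
Proof. by split=> // c d; rewrite quad_mulE; congr pair; rewrite /= ?mulr0 ?mul0r ?addr0. Qed.
HB.instance Definition _ := GRing.isZmodMorphism.Build R (quad h) quadC quadC_zmod.
HB.instance Definition _ := GRing.isMonoidMorphism.Build R (quad h) quadC quadC_monoid.

Definition quadZ : quad h := (0, 1).

Lemma quadE (f : quad h) : f = quadC f.1 + quadC f.2 * quadZ.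
Proof. by rewrite quad_mulE; case: f => p q; congr pair; rewrite /=; ring. Qed.
Lemma quadZ2 : quadZ * quadZ = quadC h.
Proof. by rewrite quad_mulE; congr pair; rewrite /=; ring. Qed.
Lemma quadM1 (f g : quad h) : (f * g).1 = f.1 * g.1 + h * (f.2 * g.2).
Proof. by rewrite quad_mulE. Qed.
Lemma quadM2 (f g : quad h) : (f * g).2 = f.1 * g.2 + f.2 * g.1.
Proof. by rewrite quad_mulE. Qed.

End QuadRing.

(** * Degrees on the affine conic *)

Lemma coefM_top (R : nzRingType) (p q : {poly R}) m n :
  (size p <= m.+1)%N -> (size q <= n.+1)%N -> (p * q)`_(m + n) = p`_m * q`_n.
Proof.
move=> sp sq; rewrite coefM.
have lt_m : (m < (m + n).+1)%N by lia.
rewrite (bigD1 (Ordinal lt_m)) //= big1 ?addr0 ?addKn // => i /eqP ne.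
have ne' : nat_of_ord i <> m by move=> e; apply: ne; apply: val_inj.
have [lt|le] := ltnP m i; first   by rewrite [p`__]nth_default ?mul0r // (leq_trans sp).
rewrite [q`__]nth_default ?mulr0 // (leq_trans sq) //; move: (ltn_ord i) => /=; lia.
Qed.

Section ConicRing.
Variables (F : fieldType) (a b : F).
Hypothesis conic_anis : forall x y z : F,
  a * (x ^+ 2 + x * y + b * y ^+ 2) + z ^+ 2 = 0 -> [/\ x = 0, y = 0 & z = 0].

(** On the chart y = 1 the conic aN(x, y) + z^2 = 0 reads z^2 = conic_poly. *)
Definition conic_poly : {poly F} := - (a%:P * ('X^2 + 'X + b%:P)).
Local Notation A := (quad conic_poly).

(** The norm from A to F[x].  It is multiplicative, and its top coefficient is a value
    of u^2 + a v^2, so that it determines the degree. *)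
Definition qnorm (f : A) : {poly F} := f.1 ^+ 2 - conic_poly * f.2 ^+ 2.

Lemma qnormM f g : qnorm (f * g) = qnorm f * qnorm g.
Proof. by rewrite /qnorm quadM1 quadM2; ring. Qed.

(** The pole order at the point at infinity of the conic, where x and z both have
    a simple pole. *)
Definition qdeg (f : A) : nat := maxn (size f.1).-1 (size f.2).
Arguments qdeg f%_ring_scope.

Lemma qdeg_le f n : (qdeg f <= n)%N = (size f.1 <= n.+1)%N && (size f.2 <= n)%N.
Proof. by rewrite /qdeg geq_max; congr andb; lia. Qed.

(** The conic has no rational point at infinity. *)
Lemma lead_anis (x y : F) : x ^+ 2 + a * y ^+ 2 = 0 -> x = 0 /\ y = 0.
Proof.
move=> e; have [//|-> _ ->] // := @conic_anis y 0 x.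
by rewrite mulr0 expr0n /= mulr0 !addr0 addrC.
Qed.

Lemma size_conic_quadratic : size ('X^2 + 'X + b%:P : {poly F}) = 3%N.
Proof.
rewrite -addrA size_polyDl ?size_polyXn //.
by rewrite (leq_ltn_trans (size_polyD _ _)) // size_polyX size_polyC; case: eqP.
Qed.

Lemma size_conic : (size conic_poly <= 3)%N.
Proof.
rewrite size_polyN (leq_trans (size_polyMleq _ _)) // size_conic_quadratic.
by rewrite size_polyC; case: eqP.
Qed.

Lemma conic_lead : conic_poly`_2 = - a.
Proof. by rewrite coefN coefCM !coefD coefXn coefX coefC /= !addr0 mulr1. Qed.

Lemma size_sqr_le (p : {poly F}) n :
  (size p <= n.+1)%N -> (size (p ^+ 2)%R <= (2 * n).+1)%N.
Proof. by move=> sp; rewrite expr2 (leq_trans (size_polyMleq _ _)) //; lia. Qed.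

Lemma size_qnorm_le f : (size (qnorm f) <= (2 * qdeg f).+1)%N.
Proof.
have /andP[s1 s2] : (size f.1 <= (qdeg f).+1)%N && (size f.2 <= qdeg f)%N.
  by rewrite -qdeg_le.
rewrite (leq_trans (size_polyD _ _)) // geq_max size_polyN size_sqr_le //=.
have [->|nz] := eqVneq f.2 0; first by rewrite expr0n mulr0 size_poly0.
move: nz s2; rewrite -size_poly_gt0; case: (qdeg f) => [|n] nz s2; first by lia.
rewrite (leq_trans (size_polyMleq _ _)) //.
have := leq_add size_conic (size_sqr_le s2); rewrite -subn1 leq_subLR => /leq_trans -> //.
lia.
Qed.

Lemma size_qnorm f : f != 0 -> size (qnorm f) = (2 * qdeg f).+1.
Proof.
move=> f0; apply/eqP; rewrite eqn_leq size_qnorm_le ltnNge; apply/negP => le.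
have /andP[s1 s2] : (size f.1 <= (qdeg f).+1)%N && (size f.2 <= qdeg f)%N.
  by rewrite -qdeg_le.
have c0 : (qnorm f)`_(2 * qdeg f) = 0 by rewrite nth_default.
move: c0 f0 s1 s2; rewrite coefB mul2n -addnn expr2 => c0 f0 s1 s2.
move: c0; rewrite coefM_top //.
have [d0|] := posnP (qdeg f).
  rewrite d0 in s1 s2 *; move: s2; rewrite leqn0 size_poly_eq0 => /eqP f2.
  rewrite f2 expr0n mulr0 coef0 subr0 => /eqP; rewrite mulf_eq0 orbb => /eqP f1.
  case/negP: f0; apply/eqP; rewrite (quadE f) f2 (size1_polyC s1) f1.
  by rewrite !rmorph0 mul0r addr0.
case E: (qdeg f) => [//|n] _; rewrite E in s1 s2 *.
have -> : (n.+1 + n.+1 = 2 + (n + n))%N by lia.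
rewrite coefM_top ?size_conic //; last by rewrite addnn -mul2n size_sqr_le.
rewrite expr2 coefM_top // conic_lead => e.
have [|f1 f2] := @lead_anis (f.1)`_n.+1 (f.2)`_n.
  by rewrite -[RHS]e; ring.
have : (qdeg f <= n)%N.
  rewrite qdeg_le; apply/andP; split; apply/leq_sizeP => j.
    by rewrite leq_eqVlt => /orP[/eqP <- //|lt]; rewrite nth_default // (leq_trans s1).
  by rewrite leq_eqVlt => /orP[/eqP <- //|lt]; rewrite nth_default // (leq_trans s2).
by rewrite E ltnn.
Qed.

Lemma qdeg0 : qdeg 0 = 0%N.
Proof. by rewrite /qdeg /= size_poly0. Qed.

Lemma qnorm_eq0 f : (qnorm f == 0) = (f == 0).
Proof.
apply/idP/idP => [|/eqP ->]; last by rewrite /qnorm /= expr0n mulr0 subr0.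
by apply: contraLR => f0; rewrite -size_poly_eq0 size_qnorm.
Qed.

Lemma quad_mulf_eq0 (f g : A) : f * g = 0 -> f = 0 \/ g = 0.
Proof.
move=> e; have : qnorm (f * g) == 0 by rewrite qnorm_eq0 e.
by rewrite qnormM mulf_eq0 !qnorm_eq0 => /orP[]/eqP ->; [left | right].
Qed.

Lemma quad_mulfI (f g k : A) : f != 0 -> f * g = f * k -> g = k.
Proof.
move=> f0 e; have [|/eqP|/eqP] := @quad_mulf_eq0 f (g - k).
- by rewrite mulrBr e subrr.
- by rewrite (negPf f0).
by rewrite subr_eq0 => /eqP.
Qed.

Lemma qdegM f g : f != 0 -> g != 0 -> qdeg (f * g) = (qdeg f + qdeg g)%N.
Proof.
move=> f0 g0; have fg0 : f * g != 0.
  by apply/eqP => /quad_mulf_eq0[]/eqP; rewrite ?(negPf f0) ?(negPf g0).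
have := size_qnorm fg0; rewrite qnormM size_mul ?qnorm_eq0 //.
by rewrite !size_qnorm //; lia.
Qed.

Lemma qdegM_le f g : (qdeg (f * g) <= qdeg f + qdeg g)%N.
Proof.
have [->|f0] := eqVneq f 0; first by rewrite mul0r qdeg0.
have [->|g0] := eqVneq g 0; first by rewrite mulr0 qdeg0.
by rewrite qdegM.
Qed.

Lemma qdegD_le f g n : (qdeg f <= n)%N -> (qdeg g <= n)%N -> (qdeg (f + g) <= n)%N.
Proof.
rewrite !qdeg_le => /andP[f1 f2] /andP[g1 g2].
by rewrite !(leq_trans (size_polyD _ _)) // geq_max ?f1 ?f2.
Qed.

Lemma qdegN f : qdeg (- f) = qdeg f.
Proof. by rewrite /qdeg /= !size_polyN. Qed.

Lemma qdegB_le f g n : (qdeg f <= n)%N -> (qdeg g <= n)%N -> (qdeg (f - g) <= n)%N.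
Proof. by move=> fn gn; rewrite qdegD_le ?qdegN. Qed.

Lemma qdeg_sum_le (I : Type) (r : seq I) (P : pred I) (f : I -> A) n :
  (forall i, P i -> qdeg (f i) <= n)%N -> (qdeg (\sum_(i <- r | P i) f i) <= n)%N.
Proof.
move=> fn; elim/big_rec: _ => [|i g Pi gn]; first by rewrite qdeg0.
by rewrite qdegD_le ?fn.
Qed.

Definition quad_const (c : F) : A := quadC conic_poly c%:P.
Local Notation kc := quad_const.
Fact kc_zmod : zmod_morphism kc.
Proof. by move=> c d; rewrite /quad_const !rmorphB. Qed.
Fact kc_monoid : monoid_morphism kc.
Proof. by split=> [|c d]; rewrite /quad_const ?rmorph1 ?rmorphM. Qed.
HB.instance Definition _ := GRing.isZmodMorphism.Build F A quad_const kc_zmod.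
HB.instance Definition _ := GRing.isMonoidMorphism.Build F A quad_const kc_monoid.

Lemma qdeg_kc c : qdeg (kc c) = 0%N.
Proof. by rewrite /qdeg /= size_polyC size_poly0 maxn0; case: eqP. Qed.

Lemma kc_eq0 c : (kc c == 0) = (c == 0).
Proof. by rewrite fmorph_eq0. Qed.

Lemma qdeg_kcM c f n : (qdeg f <= n)%N -> (qdeg (kc c * f) <= n)%N.
Proof. by move=> fn; rewrite (leq_trans (qdegM_le _ _)) // qdeg_kc. Qed.

Definition quad_x : A := quadC conic_poly 'X.
Definition quad_z : A := quadZ conic_poly.
Local Notation kx := quad_x.
Local Notation kz := quad_z.
Lemma kz2 : kz ^+ 2 = - (kc a * (kx ^+ 2 + kx + kc b)).
Proof.
by rewrite expr2 quadZ2 /quad_const /quad_x /conic_poly -rmorphXn -!rmorphD -rmorphM -rmorphN.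
Qed.
Lemma qdeg_kx : qdeg kx = 1%N.
Proof. by rewrite /qdeg /= size_polyX size_poly0. Qed.
Lemma qdeg_kz : qdeg kz = 1%N.
Proof. by rewrite /qdeg /= size_poly1 size_poly0. Qed.

Lemma qdeg0P f : (qdeg f <= 0)%N -> exists c, f = kc c.
Proof.
rewrite qdeg_le leqn0 size_poly_eq0 => /andP[s /eqP e].
by exists (f.1)`_0; rewrite {1}(quadE f) e (size1_polyC s) coefC /= rmorph0 mul0r addr0.
Qed.

End ConicRing.
Arguments qdeg {F a b} f%_ring_scope.

(** * Quadratic forms in coordinates *)

(** A quadratic map is given by any matrix M as x M x^T, with M not assumed symmetric:
    this makes sense over every commutative ring and loses nothing in characteristic 2. *)
Section MatrixForms.
Variables (R : comNzRingType) (d : nat) (M : 'M[R]_d).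
Implicit Types x y : 'rV[R]_d.

Definition mbil x y : R := (x *m M *m y^T) 0 0.
Definition mquad x : R := mbil x x.
Definition mpol x y : R := mbil x y + mbil y x.

Lemma mbilDl x1 x2 y : mbil (x1 + x2) y = mbil x1 y + mbil x2 y.
Proof. by rewrite /mbil !mulmxDl mxE. Qed.
Lemma mbilDr x y1 y2 : mbil x (y1 + y2) = mbil x y1 + mbil x y2.
Proof. by rewrite /mbil linearD mulmxDr mxE. Qed.
Lemma mbilZl c x y : mbil (c *: x) y = c * mbil x y.
Proof. by rewrite /mbil -!scalemxAl mxE. Qed.
Lemma mbilZr c x y : mbil x (c *: y) = c * mbil x y.
Proof. by rewrite /mbil linearZ /= -scalemxAr mxE. Qed.

Lemma mquadD x y : mquad (x + y) = mquad x + mquad y + mpol x y.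
Proof. by rewrite /mquad /mpol mbilDl !mbilDr; ring. Qed.
Lemma mquadZ c x : mquad (c *: x) = c ^+ 2 * mquad x.
Proof. by rewrite /mquad mbilZl mbilZr; ring. Qed.
Lemma mpolC x y : mpol x y = mpol y x.
Proof. by rewrite /mpol addrC. Qed.
Lemma mpolDl x1 x2 y : mpol (x1 + x2) y = mpol x1 y + mpol x2 y.
Proof. by rewrite /mpol mbilDl mbilDr; ring. Qed.
Lemma mpolZl c x y : mpol (c *: x) y = c * mpol x y.
Proof. by rewrite /mpol mbilZl mbilZr; ring. Qed.
Lemma mpolDr x y1 y2 : mpol x (y1 + y2) = mpol x y1 + mpol x y2.
Proof. by rewrite !(mpolC x) mpolDl. Qed.
Lemma mpolZr c x y : mpol x (c *: y) = c * mpol x y.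
Proof. by rewrite !(mpolC x) mpolZl. Qed.
Lemma mpolxx x : mpol x x = 2 * mquad x.
Proof. by rewrite /mpol /mquad; ring. Qed.
Lemma mquad0 : mquad 0 = 0.
Proof. by rewrite -(scale0r 0) mquadZ; ring. Qed.

Definition mpolE := (mquadD, mquadZ, mpolDl, mpolDr, mpolZl, mpolZr, mpolxx).

Lemma mbil_sum x y : mbil x y = \sum_i \sum_j M i j * (x 0 i * y 0 j).
Proof.
rewrite /mbil mxE exchange_big /=; apply: eq_bigr => j _.
rewrite mxE mulr_suml; apply: eq_bigr => i _; rewrite !mxE; ring.
Qed.

Lemma mquad_alt x : (forall i, M i i = 0) -> (forall i j, M i j = - M j i) ->
  mquad x = 0.
Proof.
move=> M0 MN; pose U := \matrix_(i, j) if (i < j)%N then M i j else 0.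
have E : M = U - U^T.
  apply/matrixP => i j; rewrite !mxE; case: (ltngtP i j) => [_|_|/val_inj ->].
  - by rewrite subr0.
  - by rewrite sub0r -MN.
  by rewrite M0 subrr.
rewrite /mquad /mbil E mulmxBr mulmxBl [LHS]mxE [X in _ + X]mxE.
suff -> : x *m U^T *m x^T = (x *m U *m x^T)^T by rewrite [X in _ - X]mxE subrr.
by rewrite !trmx_mul trmxK mulmxA.
Qed.
End MatrixForms.

Lemma mbil_map (R S : comNzRingType) (f : {rmorphism R -> S}) d (M : 'M[R]_d) x y :
  mbil (map_mx f M) (map_mx f x) (map_mx f y) = f (mbil M x y).
Proof. by rewrite /mbil map_trmx -!map_mxM mxE. Qed.
Lemma mquad_map (R S : comNzRingType) (f : {rmorphism R -> S}) d (M : 'M[R]_d) x :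
  mquad (map_mx f M) (map_mx f x) = f (mquad M x).
Proof. exact: mbil_map. Qed.
Lemma mpol_map (R S : comNzRingType) (f : {rmorphism R -> S}) d (M : 'M[R]_d) x y :
  mpol (map_mx f M) (map_mx f x) (map_mx f y) = f (mpol M x y).
Proof. by rewrite /mpol !mbil_map rmorphD. Qed.

Lemma mbil_delta (R : comNzRingType) d (M : 'M[R]_d) i j :
  mbil M (delta_mx 0 i) (delta_mx 0 j) = M i j.
Proof. by rewrite /mbil trmx_delta -rowE -colE !mxE. Qed.

(** A quadratic map that vanishes on R^d has an alternating matrix, and this persists
    under scalar extension.  So an identity between quadratic maps checked on vectors
    over F, even a finite F, still holds over every extension. *)
Lemma mquad_ext (R S : comNzRingType) (f : {rmorphism R -> S}) d (M : 'M[R]_d) :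
  (forall x, mquad M x = 0) -> forall x, mquad (map_mx f M) x = 0.
Proof.
move=> M0 x.
have Mii i : M i i = 0 by rewrite -[RHS](M0 (delta_mx 0 i)) /mquad mbil_delta.
apply: mquad_alt => [i|i j]; first by rewrite mxE Mii rmorph0.
rewrite !mxE -rmorphN; congr (f _); apply/eqP; rewrite -addr_eq0; apply/eqP.
have := M0 (delta_mx 0 i + delta_mx 0 j); rewrite mquadD !M0 !add0r.
by rewrite /mpol !mbil_delta.
Qed.

Section GramMatrix.
Variables (F : fieldType) (phi : qform F).
Local Notation V := (qspace phi).
Local Notation d := (qdim phi).
Local Notation e := (vbasis {: V}).

Lemma qformD v w : phi (v + w) = phi v + phi w + polar phi v w.
Proof. by rewrite /polar; ring. Qed.
Lemma qformZ c v : phi (c *: v) = c ^+ 2 * phi v.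
Proof. by have [h _] := qvalP phi; rewrite h. Qed.
Lemma polarC v w : polar phi v w = polar phi w v.
Proof. by rewrite /polar [w + v]addrC; ring. Qed.
Lemma polar_lin w : scalar (polar phi ^~ w).
Proof. by have [_ h] := qvalP phi; apply: h. Qed.
Lemma polar0l w : polar phi 0 w = 0.
Proof. by have := polar_lin w (-1) 0 0; rewrite scaler0 addr0 mulN1r addNr. Qed.
Lemma polarDl v1 v2 w : polar phi (v1 + v2) w = polar phi v1 w + polar phi v2 w.
Proof. by rewrite -[v1]scale1r polar_lin mul1r scale1r. Qed.
Lemma polarZl c v w : polar phi (c *: v) w = c * polar phi v w.
Proof. by rewrite -[c *: v]addr0 polar_lin polar0l addr0. Qed.
Lemma polarZr c v w : polar phi v (c *: w) = c * polar phi v w.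
Proof. by rewrite !(polarC v) polarZl. Qed.
Lemma polar0r v : polar phi v 0 = 0.
Proof. by rewrite polarC polar0l. Qed.
Lemma qform0 : phi 0 = 0.
Proof. by rewrite -(scale0r 0) qformZ expr0n mul0r. Qed.
Lemma polarxx v : polar phi v v = 2 * phi v.
Proof.
have -> : polar phi v v = phi (2 *: v) - phi v - phi v.
  by rewrite /polar -[2]/(1 + 1) scalerDl scale1r.
by rewrite qformZ; ring.
Qed.

(** Upper triangular: the off-diagonal polar values are counted once, without division
    by 2. *)
Definition gram : 'M[F]_d := \matrix_(i, j)
  if i == j then phi e`_i else if (i < j)%N then polar phi e`_i e`_j else 0.

Definition vec (x : 'rV[F]_d) : V := \sum_i x 0 i *: e`_i.

Lemma gram_sum (R : comNzRingType) (f : {rmorphism F -> R}) (x : 'rV[R]_d) :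
  mquad (map_mx f gram) x =
  \sum_(i < d) f (phi e`_i) * (x 0 i * x 0 i) +
  \sum_(i < d) \sum_(j < d | (i < j)%N) f (polar phi e`_i e`_j) * (x 0 i * x 0 j).
Proof.
rewrite /mquad mbil_sum -big_split; apply: eq_bigr => i _ /=.
rewrite (bigD1 i) //= !mxE eqxx; congr +%R.
rewrite [LHS](bigID (fun j : 'I_d => (i < j)%N)) /= [X in _ + X]big1 ?addr0.
  apply: eq_big => j; first by rewrite -val_eqE /=; case: ltngtP.
  by case/andP=> ne lt; rewrite !mxE eq_sym (negPf ne) lt.
move=> j /andP[ne nlt]; rewrite !mxE eq_sym (negPf ne) (negPf nlt).
by rewrite rmorph0 mul0r.
Qed.

Lemma vec_is_linear : linear vec.
Proof.
move=> c x y; rewrite /vec scaler_sumr -big_split; apply: eq_bigr => i _ /=.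
by rewrite !mxE scalerDl scalerA.
Qed.
HB.instance Definition _ := GRing.isLinear.Build F 'rV[F]_d V _ vec vec_is_linear.

Definition unvec (v : V) : 'rV[F]_d := \row_i coord e i v.
Lemma unvec_is_linear : linear unvec.
Proof. by move=> c u v; apply/rowP => i; rewrite !mxE linearP. Qed.
HB.instance Definition _ := GRing.isLinear.Build F V 'rV[F]_d _ unvec unvec_is_linear.
Lemma unvecK v : vec (unvec v) = v.
Proof.
by rewrite /vec {2}(coord_vbasis (memvf v)); apply: eq_bigr => i _; rewrite mxE.
Qed.
Lemma vecK x : unvec (vec x) = x.
Proof.
apply/rowP => i; rewrite mxE /vec coord_sum_free //.
exact: basis_free (vbasisP _).
Qed.

Lemma polar_suml (I : Type) (r : seq I) (P : pred I) (f : I -> V) w :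
  polar phi (\sum_(i <- r | P i) f i) w = \sum_(i <- r | P i) polar phi (f i) w.
Proof.
elim/big_rec2: _ => [|i x v _ e']; first by rewrite polar0l.
by rewrite polarDl e'.
Qed.

Lemma mquad_gram (x : 'rV[F]_d) : mquad gram x = phi (vec x).
Proof.
rewrite -[gram](map_mx_id (f := idfun)) //= gram_sum /=.
have main n (le : (n <= d)%N) : phi (\sum_(i < d | (i < n)%N) x 0 i *: e`_i) =
    \sum_(i < d | (i < n)%N) phi e`_i * (x 0 i * x 0 i) +
    \sum_(j < d | (j < n)%N) \sum_(i < d | (i < j)%N)
      polar phi e`_i e`_j * (x 0 i * x 0 j).
  elim: n le => [|n IH] le; first by rewrite !big_pred0 ?qform0 ?addr0.
  have step (T : nmodType) (f : 'I_d -> T) : \sum_(i < d | (i < n.+1)%N) f i =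
      \sum_(i < d | (i < n)%N) f i + f (Ordinal le).
    rewrite (bigD1 (Ordinal le)) //= addrC; congr +%R; apply: eq_bigl => i.
    by rewrite -val_eqE /=; lia.
  rewrite !step qformD IH ?(ltnW le) // qformZ polarZr polar_suml mulr_sumr /=.
  have -> : \sum_(i < d | (i < n)%N) x 0 (Ordinal le) * polar phi (x 0 i *: e`_i) e`_n
   = \sum_(i < d | (i < n)%N) polar phi e`_i e`_n * (x 0 i * x 0 (Ordinal le)).
    by apply: eq_bigr => i _; rewrite polarZl; ring.
  ring.
have all_lt i : (nat_of_ord (i : 'I_d) < d)%N = true by rewrite ltn_ord.
have := main _ (leqnn _); rewrite !(eq_bigl _ _ all_lt) => ->; congr +%R.
rewrite (exchange_big_dep predT) //=.
Qed.

Lemma mpol_gram x y : mpol gram x y = polar phi (vec x) (vec y).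
Proof. by rewrite /polar -linearD -!mquad_gram mquadD; ring. Qed.

Lemma isotropic_mquad : isotropic phi <-> exists x, x != 0 /\ mquad gram x = 0.
Proof.
split=> [[v [v0 e0]]|[x [x0 e0]]].
  exists (unvec v); rewrite mquad_gram unvecK e0; split=> //.
  by apply: contraNneq v0 => u0; rewrite -(unvecK v) u0 linear0.
exists (vec x); rewrite -mquad_gram e0; split=> //.
by apply: contraNneq x0 => u0; rewrite -(vecK x) u0 linear0.
Qed.

Lemma isotropic_qext (K : fieldType) (f : {rmorphism F -> K}) :
  isotropic (qext f phi) <-> exists x, x != 0 /\ mquad (map_mx f gram) x = 0.
Proof. by split=> -[x [x0 e0]]; exists x; rewrite gram_sum in e0 *. Qed.

End GramMatrix.

(** * Ideals of the conic ring in lowest degree *)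

Section LowestDegree.
Variables (F : fieldType) (a b : F).
Hypothesis conic_anis : forall x y z : F,
  a * (x ^+ 2 + x * y + b * y ^+ 2) + z ^+ 2 = 0 -> [/\ x = 0, y = 0 & z = 0].
Local Notation A := (quad (conic_poly a b)).
Local Notation kc := (@quad_const F a b).
Local Notation kx := (@quad_x F a b).
Local Notation kz := (@quad_z F a b).
Implicit Types f g : A.

Lemma qdeg_pred f n : (qdeg f <= n.+1)%N ->
  (f.1)`_n.+1 = 0 -> (f.2)`_n = 0 -> (qdeg f <= n)%N.
Proof.
rewrite !qdeg_le => /andP[s1 s2] f1 f2; apply/andP; split; apply/leq_sizeP => j.
  by rewrite leq_eqVlt => /orP[/eqP <- //|lt]; rewrite nth_default // (leq_trans s1).
by rewrite leq_eqVlt => /orP[/eqP <- //|lt]; rewrite nth_default // (leq_trans s2).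
Qed.

Lemma coef_kcM1 c f i : ((kc c * f).1)`_i = c * (f.1)`_i.
Proof. by rewrite quadM1 /= mul0r mulr0 addr0 coefCM. Qed.
Lemma coef_kcM2 c f i : ((kc c * f).2)`_i = c * (f.2)`_i.
Proof. by rewrite quadM2 /= mul0r addr0 coefCM. Qed.
Lemma coef_kx1 f i : ((kx * f).1)`_i.+1 = (f.1)`_i.
Proof. by rewrite quadM1 /= mul0r mulr0 addr0 coefXM. Qed.
Lemma coef_kx2 f i : ((kx * f).2)`_i.+1 = (f.2)`_i.
Proof. by rewrite quadM2 /= mul0r addr0 coefXM. Qed.
Lemma coef_kz1 f n : (size f.2 <= n.+1)%N -> ((kz * f).1)`_n.+2 = - a * (f.2)`_n.
Proof.
move=> s; rewrite quadM1 /= mul0r add0r mul1r.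
by rewrite (@coefM_top _ _ _ 2 n) ?size_conic ?conic_lead.
Qed.
Lemma coef_kz2 f i : ((kz * f).2)`_i = (f.1)`_i.
Proof. by rewrite quadM2 /= mul0r add0r mul1r. Qed.
Lemma coefD1 f g i : ((f + g).1)`_i = (f.1)`_i + (g.1)`_i.
Proof. by rewrite coefD. Qed.
Lemma coefD2 f g i : ((f + g).2)`_i = (f.2)`_i + (g.2)`_i.
Proof. by rewrite coefD. Qed.
Lemma coefN1 f i : ((- f).1)`_i = - (f.1)`_i.
Proof. by rewrite coefN. Qed.
Lemma coefN2 f i : ((- f).2)`_i = - (f.2)`_i.
Proof. by rewrite coefN. Qed.

Lemma coef_kc1 c i : ((kc c).1)`_i = if i == 0%N then c else 0.
Proof. by rewrite coefC. Qed.

Lemma quad_free4 u0 u1 u2 u3 u4 t0 t1 t2 t3 :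
  kc u0 + kc u1 * kx + kc u2 * kx ^+ 2 + kc u3 * kx ^+ 3 + kc u4 * kx ^+ 4 +
  (kc t0 + kc t1 * kx + kc t2 * kx ^+ 2 + kc t3 * kx ^+ 3) * kz = 0 ->
  [/\ u0 = 0, u1 = 0, u2 = 0, u3 = 0 & u4 = 0] /\
  [/\ t0 = 0, t1 = 0, t2 = 0 & t3 = 0].
Proof.
move=> e.
pose P := Poly [:: u0; u1; u2; u3; u4]; pose Q := Poly [:: t0; t1; t2; t3].
have {e} [P0 Q0] : P = 0 /\ Q = 0.
  suff : quadC (conic_poly a b) P + quadC (conic_poly a b) Q * kz = 0.
    by rewrite quad_mulE => -[/= e1 e2]; split;
      [rewrite -[RHS]e1 | rewrite -[RHS]e2]; ring.
  rewrite -[RHS]e /P /Q /= !cons_poly_def !(rmorphD, rmorphM, rmorph0).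
  by rewrite /quad_const /quad_x; ring.
have cP i : P`_i = 0 by rewrite P0 coef0.
have cQ i : Q`_i = 0 by rewrite Q0 coef0.
move: (cP 0%N) (cP 1%N) (cP 2%N) (cP 3%N) (cP 4%N) (cQ 0%N) (cQ 1%N) (cQ 2%N) (cQ 3%N).
by rewrite !coef_Poly.
Qed.

(** If th were not a multiple of g, the leading terms of g and th would span those of
    degree n+1, so x th and z th could be reduced to combinations of x g, z g, g and th.
    This expresses th / g both as (e1 x + e2 z + c1) / (x - c2) and with denominator
    z - c4; equating the two makes (c2, c4) a rational point of the conic. *)
Lemma ideal_lowest_line (J : A -> Prop) n g th :
  (forall f f', J f -> J f' -> J (f + f')) -> (forall k f, J f -> J (k * f)) ->
  (forall f, J f -> (qdeg f <= n)%N -> f = 0) ->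
  J g -> J th -> qdeg g = n.+1 -> (qdeg th <= n.+1)%N ->
  exists c, th = kc c * g.
Proof.
move=> JD JM Jlow Jg Jth dg dth.
have JZ k f f' : J f -> J f' -> J (f - k * f').
  by move=> Jf Jf'; rewrite -mulNr; apply: JD => //; apply: JM.
have /andP[sg1 sg2] : (size g.1 <= n.+2)%N && (size g.2 <= n.+1)%N.
  by rewrite -qdeg_le dg.
have /andP[st1 st2] : (size th.1 <= n.+2)%N && (size th.2 <= n.+1)%N.
  by rewrite -qdeg_le.
set al := (g.1)`_n.+1; set be := (g.2)`_n.
set ga := (th.1)`_n.+1; set de := (th.2)`_n.
have D0 : al ^+ 2 + a * be ^+ 2 != 0.
  apply/eqP => /(lead_anis conic_anis)[al0 be0].
  by have := qdeg_pred (eq_leq dg) al0 be0; rewrite dg ltnn.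
(* the leading term of th is e1 + e2 z/x times that of g *)
pose e1 := (al * ga + a * be * de) / (al ^+ 2 + a * be ^+ 2).
pose e2 := (al * de - be * ga) / (al ^+ 2 + a * be ^+ 2).
have E1 : ga = e1 * al - a * e2 * be by rewrite /e1 /e2; field.
have E2 : de = e1 * be + e2 * al by rewrite /e1 /e2; field.
have simp := (coefD1, coefD2, coefN1, coefN2, coef_kcM1, coef_kcM2, coef_kx1,
  coef_kx2, coef_kz1, coef_kz2).
(* if e2 = 0 then th - e1 g has lower degree *)
have [e20|e20] := eqVneq e2 0.
  exists e1; apply/eqP; rewrite -subr_eq0; apply/eqP; apply: Jlow.
    exact: JZ.
  apply: qdeg_pred.
  - by rewrite qdegB_le // qdeg_kcM // dg.
  - by rewrite !simp -/al -/ga E1 e20; ring.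
  by rewrite !simp -/be -/de E2 e20; ring.
have Delta : al * de - be * ga != 0.
  have -> : al * de - be * ga = e2 * (al ^+ 2 + a * be ^+ 2) by rewrite E1 E2; ring.
  by rewrite mulf_neq0.
have span f : J f -> (qdeg f <= n.+1)%N -> exists c c', f = kc c * g + kc c' * th.
  move=> Jf df; set p := (f.1)`_n.+1; set q := (f.2)`_n.
  exists ((p * de - q * ga) / (al * de - be * ga)).
  exists ((al * q - be * p) / (al * de - be * ga)).
  apply/eqP; rewrite -subr_eq0 opprD addrA; apply/eqP; apply: Jlow.
    by apply: (JZ); first apply: JZ.
  apply: qdeg_pred.
  - by rewrite !qdegB_le // qdeg_kcM // dg.
  - by rewrite !simp -/al -/ga -/p; field.
  by rewrite !simp -/be -/de -/q; field.
have dx f : (qdeg f <= n.+1)%N -> (qdeg (kx * f)%R <= n.+2)%N.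
  move=> df; rewrite (leq_trans (qdegM_le conic_anis _ _)) // qdeg_kx; lia.
have dz f : (qdeg f <= n.+1)%N -> (qdeg (kz * f)%R <= n.+2)%N.
  move=> df; rewrite (leq_trans (qdegM_le conic_anis _ _)) // qdeg_kz; lia.
have [||c1 [c2 F1]] := span (kx * th - kc e1 * (kx * g) - kc e2 * (kz * g)).
- by apply: (JZ); [apply: (JZ)|]; apply: (JM).
- apply: qdeg_pred.
  + by rewrite !qdegB_le ?dx // qdeg_kcM ?dx ?dz ?dg.
  + by rewrite !simp // -/al -/be -/ga E1; ring.
  by rewrite !simp // -/al -/be -/de E2; ring.
have [||c3 [c4 F2]] := span (kz * th - kc (- a * e2) * (kx * g) - kc e1 * (kz * g)).
- by apply: (JZ); [apply: (JZ)|]; apply: (JM).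
- apply: qdeg_pred.
  + by rewrite !qdegB_le ?dz // qdeg_kcM ?dx ?dz ?dg.
  + by rewrite !simp // -/al -/be -/de E2; ring.
  by rewrite !simp // -/al -/be -/ga E1; ring.
have G1 : th * (kx - kc c2) = g * (kc e1 * kx + kc e2 * kz + kc c1).
  transitivity (kx * th - kc e1 * (kx * g) - kc e2 * (kz * g) - kc c2 * th
    + kc e1 * (kx * g) + kc e2 * (kz * g)); first by ring.
  by rewrite F1; ring.
have G2 : th * (kz - kc c4) = g * (kc (- a * e2) * kx + kc e1 * kz + kc c3).
  transitivity (kz * th - kc (- a * e2) * (kx * g) - kc e1 * (kz * g) - kc c4 * th
    + kc (- a * e2) * (kx * g) + kc e1 * (kz * g)); first by ring.
  by rewrite F2; ring.
have g0 : g != 0 by apply/eqP => g0; rewrite g0 qdeg0 in dg.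
(* the two expressions of th / g agree *)
have G3 : (kc e1 * kx + kc e2 * kz + kc c1) * (kz - kc c4) =
    (kc (- a * e2) * kx + kc e1 * kz + kc c3) * (kx - kc c2).
  apply: (quad_mulfI conic_anis g0); rewrite [LHS]mulrA [RHS]mulrA -G1 -G2; ring.
have [|[u0 u1 _ _ _] [u2 _ _ _]] := @quad_free4 (c3 * c2 - c1 * c4 - a * b * e2)
    (- a * e2 - e1 * c4 - c3 - a * e2 * c2) 0 0 0 (c1 - e2 * c4 + e1 * c2) 0 0 0.
  have := kz2 a b; set Z2 := kz ^+ 2 => EZ.
  transitivity ((kc e1 * kx + kc e2 * kz + kc c1) * (kz - kc c4) -
    (kc (- a * e2) * kx + kc e1 * kz + kc c3) * (kx - kc c2) -
    kc e2 * (kz ^+ 2 - - (kc a * (kx ^+ 2 + kx + kc b)))); first by ring.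
  by rewrite G3 -/Z2 EZ; ring.
have C1 : c1 = e2 * c4 - e1 * c2 by apply/eqP; rewrite -subr_eq0 -u2; apply/eqP; ring.
have C3 : c3 = - a * e2 - e1 * c4 - a * e2 * c2.
  by apply/eqP; rewrite eq_sym -subr_eq0 -u1; apply/eqP; ring.
have : e2 * (a * (c2 ^+ 2 + c2 * 1 + b * 1 ^+ 2) + c4 ^+ 2) = 0.
  by rewrite -[RHS]oppr0 -u0 C1 C3; ring.
move/eqP; rewrite mulf_eq0 (negPf e20) => /eqP /conic_anis[_ /eqP].
by rewrite oner_eq0.
Qed.
End LowestDegree.

(** * Lowering the degree of an isotropic vector *)

Lemma exists_kernel2 (F : fieldType) (U W : vectType F) (f : {linear U -> W}) (v : U) :
  (dim W + 2 <= dim U)%N -> exists2 u, f u = 0 & forall c, u <> c *: v.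
Proof.
move=> le; pose K := lker (linfun f).
have dK : (2 <= \dim K)%N.
  have := limg_ker_dim (linfun f) fullv; rewrite capfv dimvf.
  have := dimvS (subvf (limg (linfun f))); rewrite dimvf -/K => h e.
  by rewrite -(leq_add2r (dim W)) addnC (leq_trans le) // -e leq_add2l.
have /subvPn[u uK unv] : ~~ (K <= <[v]>)%VS.
  apply/negP => /dimvS; rewrite dim_vline; case: eqP => _ /(leq_trans dK) //.
exists u; first by move: uK; rewrite memv_ker lfunE /= => /eqP.
by move=> c e; move/negP: unv; apply; rewrite e memvZ // memv_line.
Qed.

Lemma reflection_factor (R : comNzRingType) d (v y : 'rV[R]_d) (t g p q : R) :
  g ^+ 2 *: (p *: v - q *: y) =
  (g ^+ 2 * p - t * g * q) *: v - (- g * q) *: (t *: v + (- g) *: y).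
Proof. by apply/rowP => i; rewrite !mxE; ring. Qed.

Section Descent.
Variables (F : fieldType) (a b : F).
Hypothesis conic_anis : forall x y z : F,
  a * (x ^+ 2 + x * y + b * y ^+ 2) + z ^+ 2 = 0 -> [/\ x = 0, y = 0 & z = 0].
Local Notation A := (quad (conic_poly a b)).
Local Notation kc := (@quad_const F a b).
Local Notation kx := (@quad_x F a b).
Local Notation kz := (@quad_z F a b).
Implicit Types f g : A.

Definition quad_of n (p : 'rV[F]_n.+1) (q : 'rV[F]_n) : A := (rVpoly p, rVpoly q).

Lemma quad_of_deg n (p : 'rV[F]_n.+1) (q : 'rV[F]_n) : (qdeg (quad_of p q) <= n)%N.
Proof. by rewrite qdeg_le /= !size_poly. Qed.

Lemma quad_ofK n f : (qdeg f <= n)%N ->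
  quad_of (poly_rV f.1 : 'rV_n.+1) (poly_rV f.2 : 'rV_n) = f.
Proof.
by rewrite qdeg_le => /andP[s1 s2]; rewrite /quad_of !poly_rV_K //; case: f s1 s2.
Qed.

Lemma quad_of_linear n c (p p' : 'rV[F]_n.+1) (q q' : 'rV[F]_n) :
  quad_of (c *: p + p') (c *: q + q') = kc c * quad_of p q + quad_of p' q'.
Proof.
rewrite quad_mulE; congr pair; rewrite linearP /= -mul_polyC.
  by rewrite mul0r mulr0 addr0.
by rewrite mul0r addr0.
Qed.

(** The pairs (th, y) with entries of degree at most n+1 form a space of dimension
    (k+1)(2n+3), and bounding the degree of every th h_j - g y_j by n imposes k(2n+4)
    conditions.  At least two dimensions remain, while the obvious solution
    (th, y) = (g, h) spans one. *)
Lemma common_multiplier n k g (h : 'I_k -> A) :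
  (k <= (2 * n).+1)%N -> qdeg g = n.+1 -> (forall j, qdeg (h j) <= n.+1)%N ->
  exists (th : A) (y : 'I_k -> A),
  [/\ (qdeg th <= n.+1)%N, forall j, (qdeg (y j) <= n.+1)%N,
      forall j, (qdeg (th * h j - g * y j)%R <= n)%N
    & forall c, th <> kc c * g].
Proof.
move=> kn dg dh.
pose U : vectType F := ('rV[F]_n.+2 * 'rV[F]_n.+1 * ('M[F]_(k, n.+2) * 'M[F]_(k, n.+1)))%type.
pose W : vectType F := ('M[F]_(k, n.+2) * 'M[F]_(k, n.+2))%type.
pose th (u : U) := quad_of u.1.1 u.1.2.
pose y (u : U) j := quad_of (row j u.2.1) (row j u.2.2).
pose res u j := th u * h j - g * y u j.
have thP c u v : th (c *: u + v) = kc c * th u + th v by exact: quad_of_linear.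
have yP c u v j : y (c *: u + v) j = kc c * y u j + y v j.
  by rewrite /y -quad_of_linear; congr quad_of; apply/rowP => i; rewrite !mxE.
have resP c u v j : res (c *: u + v) j = kc c * res u j + res v j.
  by rewrite /res thP yP; ring.
pose f (u : U) : W := (\matrix_(j, i) ((res u j).1)`_(n.+1 + i),
                       \matrix_(j, i) ((res u j).2)`_(n + i)).
have fP : linear f.
  move=> c u v; congr pair; apply/matrixP => j i; rewrite !mxE resP.
    by rewrite coefD1 coef_kcM1.
  by rewrite coefD2 coef_kcM2.
pose fL := HB.pack_for {linear U -> W} f (GRing.isLinear.Build F U W _ f fP).
pose u0 : U := ((poly_rV g.1, poly_rV g.2),
  (\matrix_(j, i) ((h j).1)`_i, \matrix_(j, i) ((h j).2)`_i)).
have [|u fu nu] := @exists_kernel2 F U W fL u0.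
  have dimU : dim U = (1 * n.+2 + 1 * n.+1 + (k * n.+2 + k * n.+1))%N by [].
  have -> : dim W = (k * n.+2 + k * n.+2)%N by [].
  by rewrite dimU; lia.
have dth : (qdeg (th u) <= n.+1)%N by apply: quad_of_deg.
have dy j : (qdeg (y u j) <= n.+1)%N by apply: quad_of_deg.
have dres j : (qdeg (res u j) <= n)%N.
  have : (qdeg (res u j) <= n.+1 + n.+1)%N.
    apply: qdegB_le; rewrite (leq_trans (qdegM_le conic_anis _ _)) //.
      by apply: leq_add.
    by rewrite dg; apply: leq_add.
  rewrite !qdeg_le => /andP[s1 s2]; case: fu => /matrixP f1 /matrixP f2.
  apply/andP; split; apply/leq_sizeP => i le.
    have [lt|ge] := ltnP i (n.+1 + n.+2); last first.
      by rewrite nth_default // (leq_trans s1) //; lia.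
    (* coefficients n+1, ..., 2n+2 vanish by the choice of u *)
    have lt' : (i - n.+1 < n.+2)%N by lia.
    by have := f1 j (Ordinal lt'); rewrite !mxE /= subnKC.
  have [lt|ge] := ltnP i (n + n.+2); last first.
    by rewrite nth_default // (leq_trans s2) //; lia.
  have lt' : (i - n < n.+2)%N by lia.
  by have := f2 j (Ordinal lt'); rewrite !mxE /= subnKC.
exists (th u), (y u); split=> // c e; apply: (nu c).
have yj j : y u j = kc c * h j.
  apply/eqP; rewrite -subr_eq0; apply: contraTT (dres j) => ne.
  have -> : res u j = - g * (y u j - kc c * h j) by rewrite /res e; ring.
  rewrite -ltnNge qdegM // ?qdegN ?dg; first by lia.
  by rewrite oppr_eq0; apply/eqP => g0; rewrite g0 qdeg0 in dg.
have eqU (v w : U) : th v = th w -> (forall j, y v j = y w j) -> v = w.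
  case: v w => [[p q] [P Q]] [[p' q'] [P' Q']]; rewrite /th /y /= => -[e1 e2] ey.
  rewrite (can_inj rVpolyK e1) (can_inj rVpolyK e2).
  have -> : P = P'.
    by apply/row_matrixP => j; have [/(can_inj rVpolyK)] := ey j.
  congr (_, (_, _)).
  by apply/row_matrixP => j; have [_ /(can_inj rVpolyK)] := ey j.
have Z v : c *: v = c *: v + 0 by rewrite addr0.
have th0 : th 0 = 0 by congr pair; rewrite linear0.
have y0 j : y 0 j = 0 by congr pair; rewrite row0 linear0.
apply: eqU => [|j].
  by rewrite Z thP th0 addr0 e /th /u0 /= quad_ofK // dg.
rewrite Z yP y0 addr0 yj; congr (_ * _).
rewrite /y /u0 /= -[LHS](@quad_ofK n.+1) //; congr quad_of; apply/rowP => i.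
  by rewrite !mxE.
by rewrite !mxE.
Qed.

Lemma qdeg_mbil d (M : 'M[F]_d) (u v : 'rV[A]_d) m n :
  (forall i, qdeg (u 0 i)%R <= m)%N -> (forall i, qdeg (v 0 i)%R <= n)%N ->
  (qdeg (mbil (map_mx kc M) u v) <= m + n)%N.
Proof.
move=> du dv; rewrite mbil_sum; apply: qdeg_sum_le => i _; apply: qdeg_sum_le => j _.
rewrite mxE qdeg_kcM // (leq_trans (qdegM_le conic_anis _ _)) //.
exact: leq_add.
Qed.

Lemma quad_mul_row_eq0 d (f : A) (v : 'rV[A]_d) : f *: v = 0 -> f = 0 \/ v = 0.
Proof.
move=> e; have [f0|f0] := eqVneq f 0; [by left | right].
apply/rowP => i; have /rowP/(_ i) := e; rewrite !mxE.
by move/(quad_mulf_eq0 conic_anis) => [/eqP|//]; rewrite (negPf f0).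
Qed.

Lemma qdeg_cancel g f m n : qdeg g = m -> g != 0 -> (qdeg (g * f)%R <= m + n)%N ->
  (qdeg f <= n)%N.
Proof.
move=> dg g0; have [->|f0] := eqVneq f 0; first by rewrite qdeg0.
by rewrite qdegM // dg leq_add2l.
Qed.

(** With th and y as in common_multiplier, let Y be obtained from v by replacing (g, h)
    by (th, y).  Then u = th v - g Y has degree at most n.  It is the vector sought
    if it is nonzero and isotropic.  If its value is nonzero, the reflection of v along
    u is divisible by g^2, and the quotient has degree at most n.  If u = 0, the
    multipliers f with g | f v form an ideal containing g and the independent th, so by
    ideal_lowest_line it has a nonzero element f of degree at most n, and f v / g has
    degree at most n. *)
Lemma descent n k d (M : 'M[F]_d) (v : 'rV[A]_d) g (h : 'I_k -> A)
    (s : 'I_d -> F) (S : 'I_d -> 'I_k -> F) :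
  (k <= (2 * n).+1)%N -> qdeg g = n.+1 -> (forall j, qdeg (h j) <= n.+1)%N ->
  (forall i, v 0 i = kc (s i) * g + \sum_j kc (S i j) * h j) ->
  v != 0 -> mquad (map_mx kc M) v = 0 ->
  exists w : 'rV[A]_d, [/\ w != 0, mquad (map_mx kc M) w = 0
                         & forall i, (qdeg (w 0 i)%R <= n)%N].
Proof.
move=> kn dg dh vE v0 qv; have dM := @qdeg_mbil d M.
move: (map_mx kc M) qv dM => MA qv dM {M}.
have g0 : g != 0 by apply/eqP => g0; rewrite g0 qdeg0 in dg.
have [th [y [dth dy dr thg]]] := common_multiplier kn dg dh.
have dv i : (qdeg (v 0 i)%R <= n.+1)%N.
  rewrite vE qdegD_le ?qdeg_kcM ?dg // qdeg_sum_le // => j _.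
  by rewrite qdeg_kcM ?dh.
have [Y YE] : exists Y : 'rV[A]_d,
    forall i, Y 0 i = kc (s i) * th + \sum_j kc (S i j) * y j.
  by exists (\row_i (kc (s i) * th + \sum_j kc (S i j) * y j)) => i; rewrite mxE.
have [u uE] : exists u, u = th *: v + (- g) *: Y by exists (th *: v + (- g) *: Y).
have du i : (qdeg (u 0 i)%R <= n)%N.
  have -> : u 0 i = \sum_j kc (S i j) * (th * h j - g * y j).
    rewrite uE !mxE vE YE !mulrDr !mulr_sumr addrACA.
    rewrite [X in X + _](_ : _ = 0) ?add0r; last by ring.
    by rewrite -big_split; apply: eq_bigr => j _ /=; ring.
  by rewrite qdeg_sum_le // => j _; rewrite qdeg_kcM.
have cancel_scale f (z : 'rV[A]_d) : f *: v = g *: z -> z = 0 -> f = 0.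
  move=> e z0; have [] // : f = 0 \/ v = 0.
    by apply: quad_mul_row_eq0; rewrite e z0 scaler0.
  by move/eqP; rewrite (negPf v0).
have isotropic_scale f (z : 'rV[A]_d) : f *: v = g *: z -> mquad MA z = 0.
  move=> e; have e2 : g * (g * mquad MA z) = 0.
    transitivity (mquad MA (g *: z)); first by rewrite mquadZ; ring.
    by rewrite -e mquadZ qv mulr0.
  have [/eqP|/(quad_mulf_eq0 conic_anis) [/eqP|//]] := quad_mulf_eq0 conic_anis e2;
    by rewrite (negPf g0).
have [u0|u0] := eqVneq u 0; last first.
  have [qu|qu] := eqVneq (mquad MA u) 0; first by exists u.
  have [w wE] : exists w, w = mquad MA Y *: v - mpol MA v Y *: Y.
    by exists (mquad MA Y *: v - mpol MA v Y *: Y).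
  have qw : mquad MA w = 0 by rewrite wE -scaleNr !mpolE qv; ring.
  (* up to the scalar mquad u, the reflection of v along u is g^2 w *)
  have gw : g ^+ 2 *: w = mquad MA u *: v - mpol MA u v *: u.
    have -> : mquad MA u = g ^+ 2 * mquad MA Y - th * g * mpol MA v Y.
      by rewrite uE !mpolE qv; ring.
    have -> : mpol MA u v = - g * mpol MA v Y.
      by rewrite uE !mpolE qv [mpol MA Y v]mpolC; ring.
    by rewrite uE wE; apply: reflection_factor.
  exists w; split=> //.
    apply/eqP => w0; move: gw; rewrite w0 scaler0 => /esym /eqP.
    rewrite subr_eq0 => /eqP e.
    have e2 : mpol MA u v * (mpol MA u v * mquad MA u) = 0.
      transitivity (mquad MA (mpol MA u v *: u)); first by rewrite mquadZ; ring.
      by rewrite -e mquadZ qv mulr0.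
    have p0 : mpol MA u v = 0.
      have [//|/(quad_mulf_eq0 conic_anis) [//|/eqP]] := quad_mulf_eq0 conic_anis e2.
      by rewrite (negPf qu).
    have [/eqP|/eqP] : mquad MA u = 0 \/ v = 0.
    + by apply: quad_mul_row_eq0; rewrite e p0 scale0r.
    + by rewrite (negPf qu).
    by rewrite (negPf v0).
  move=> i; apply: (@qdeg_cancel (g ^+ 2) _ (n.+1 + n.+1)).
  - by rewrite expr2 qdegM // dg.
  - by apply/eqP; rewrite expr2 => /(quad_mulf_eq0 conic_anis)[]/eqP; rewrite (negPf g0).
  have -> : g ^+ 2 * w 0 i = mquad MA u * v 0 i - mpol MA u v * u 0 i.
    by have /rowP/(_ i) := gw; rewrite !mxE.
  have dqu : (qdeg (mquad MA u) <= n + n)%N by apply: dM.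
  have dpu : (qdeg (mpol MA u v) <= n + n.+1)%N.
    by apply: qdegD_le; [|rewrite addnC]; apply: dM.
  apply: qdegB_le; rewrite (leq_trans (qdegM_le conic_anis _ _)) //.
    by have := leq_add dqu (dv i); lia.
  by have := leq_add dpu (du i); lia.
have thv : th *: v = g *: Y.
  by apply/eqP; rewrite -subr_eq0 -scaleNr -uE u0.
have [[w [w0 qw dw]]|none] := classic (exists w : 'rV[A]_d,
  [/\ w != 0, mquad MA w = 0 & forall i, (qdeg (w 0 i)%R <= n)%N]); first by exists w.
pose J f := exists z : 'rV[A]_d, f *: v = g *: z.
have [|||||||c e] := @ideal_lowest_line F a b conic_anis J n g th; last 1 first.
- by case: (thg c).
- by move=> f f' [z e] [z' e']; exists (z + z'); rewrite scalerDl scalerDr e e'.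
- by move=> f f' [z e]; exists (f *: z); rewrite -scalerA e !scalerA mulrC.
- move=> f [z e] df; have [z0|z0] := eqVneq z 0; first exact: cancel_scale e z0.
  case: none; exists z; split=> //; first exact: isotropic_scale e.
  move=> i; apply: (@qdeg_cancel g _ n.+1) => //.
  have -> : g * z 0 i = f * v 0 i by have /rowP/(_ i) := e; rewrite !mxE.
  by rewrite (leq_trans (qdegM_le conic_anis _ _)) // addnC leq_add.
- by exists v.
- by exists Y.
- exact: dg.
- exact: dth.
Qed.

End Descent.

(** * Isotropic vectors of degree at most two *)

Lemma big_ord5 (V : nmodType) (f : 'I_5 -> V) :
  \sum_k f k = f 0 + f 1 + f 2 + f 3 + f 4.
Proof.
rewrite !big_ord_recr big_ord0 /= add0r.
by congr (f _ + f _ + f _ + f _ + f _); apply: val_inj.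
Qed.

Section LowDegree.
Variables (F : fieldType) (a b : F).
Hypothesis conic_anis : forall x y z : F,
  a * (x ^+ 2 + x * y + b * y ^+ 2) + z ^+ 2 = 0 -> [/\ x = 0, y = 0 & z = 0].
Local Notation A := (quad (conic_poly a b)).
Local Notation kc := (@quad_const F a b).
Local Notation kx := (@quad_x F a b).
Local Notation kz := (@quad_z F a b).

Definition mon2 (k : 'I_5) : A := nth 0 [:: 1; kx; kz; kx ^+ 2; kx * kz] k.

Lemma mon2_decomp f : (qdeg f <= 2)%N ->
  f = kc (f.1)`_0 + kc (f.1)`_1 * kx + kc (f.2)`_0 * kz + kc (f.1)`_2 * kx ^+ 2
      + kc (f.2)`_1 * (kx * kz).
Proof.
rewrite qdeg_le => /andP[s1 s2].
have E1 : f.1 = Poly [:: (f.1)`_0; (f.1)`_1; (f.1)`_2].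
  apply/polyP => i; rewrite coef_Poly.
  by case: i => [|[|[|i]]] //=; rewrite nth_nil nth_default // (leq_trans s1).
have E2 : f.2 = Poly [:: (f.2)`_0; (f.2)`_1].
  apply/polyP => i; rewrite coef_Poly.
  by case: i => [|[|i]] //=; rewrite nth_nil nth_default // (leq_trans s2).
rewrite {1}(quadE f) {1}E1 {1}E2 /= !cons_poly_def !(rmorphD, rmorphM, rmorph0).
by rewrite /quad_const /quad_x /quad_z; ring.
Qed.

Lemma mon2_lead1 k : ((mon2 k).1)`_2 = (k == 3 :> nat)%:R.
Proof.
case: k => [[|[|[|[|[|//]]]]]] ?; rewrite /mon2 /=.
- by rewrite coef1.
- by rewrite coefX.
- by rewrite coef0.
- by rewrite expr2 coef_kx1 coefX.
by rewrite coef_kx1 coef0.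
Qed.

Lemma mon2_lead2 k : ((mon2 k).2)`_1 = (k == 4 :> nat)%:R.
Proof.
case: k => [[|[|[|[|[|//]]]]]] ?; rewrite /mon2 /=.
- by rewrite coef0.
- by rewrite coef0.
- by rewrite coef1.
- by rewrite expr2 coef_kx2 coef0.
by rewrite coef_kx2 coef1.
Qed.

Lemma mon2_deg k : (qdeg (mon2 k) <= 2)%N.
Proof.
have dM := qdegM_le conic_anis.
case: k => [[|[|[|[|[|//]]]]]] ? /=; rewrite /mon2 /=.
- by rewrite -[1](rmorph1 kc) qdeg_kc.
- by rewrite qdeg_kx.
- by rewrite qdeg_kz.
- by rewrite expr2 (leq_trans (dM _ _)) // qdeg_kx.
by rewrite (leq_trans (dM _ _)) // qdeg_kx qdeg_kz.
Qed.

Section Form.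
Variables (d : nat) (M : 'M[F]_d).
Hypothesis M_anis : forall x, mquad M x = 0 -> x = 0.
Local Notation MA := (map_mx kc M).

Definition row2 (w : 'I_5 -> 'rV[F]_d) : 'rV[A]_d := \sum_k mon2 k *: map_mx kc (w k).

Lemma row2E w : row2 w = map_mx kc (w 0) + kx *: map_mx kc (w 1) +
  kz *: map_mx kc (w 2) + kx ^+ 2 *: map_mx kc (w 3) + (kx * kz) *: map_mx kc (w 4).
Proof.
rewrite /row2 big_ord5.
have -> : mon2 0 = 1 by [].
by rewrite scale1r.
Qed.

Lemma row2_decomp (v : 'rV[A]_d) : (forall i, qdeg (v 0 i)%R <= 2)%N ->
  exists w, v = row2 w /\ ((forall i, qdeg (v 0 i)%R <= 1)%N -> w 3 = 0 /\ w 4 = 0).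
Proof.
move=> dv.
exists (fun k => nth 0 [:: \row_i ((v 0 i).1)`_0; \row_i ((v 0 i).1)`_1;
  \row_i ((v 0 i).2)`_0; \row_i ((v 0 i).1)`_2; \row_i ((v 0 i).2)`_1] k).
split.
  by rewrite row2E /=; apply/rowP => i; rewrite !mxE {1}[v 0 i]mon2_decomp //; ring.
move=> dv1; split; apply/rowP => i; rewrite !mxE /=;
  by have := dv1 i; rewrite qdeg_le => /andP[s1 s2]; rewrite nth_default.
Qed.

(** Coefficients of 1, x, ..., x^4 and z, xz, x^2 z, x^3 z in the value of the form. *)
Lemma mquad_row2 w : mquad MA (row2 w) = 0 ->
  [/\ mquad M (w 0) = a * b * mquad M (w 2),
      mpol M (w 0) (w 1) = a * (mquad M (w 2) + b * mpol M (w 2) (w 4)),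
      mquad M (w 1) + mpol M (w 0) (w 3) =
        a * (mquad M (w 2) + mpol M (w 2) (w 4) + b * mquad M (w 4)),
      mpol M (w 1) (w 3) = a * (mpol M (w 2) (w 4) + mquad M (w 4))
    & mquad M (w 3) = a * mquad M (w 4)] /\
  [/\ mpol M (w 0) (w 2) = 0, mpol M (w 1) (w 2) + mpol M (w 0) (w 4) = 0,
      mpol M (w 1) (w 4) + mpol M (w 2) (w 3) = 0 & mpol M (w 3) (w 4) = 0].
Proof.
rewrite row2E => e.
have := kz2 a b; set Z2 := kz ^+ 2 => EZ.
have [] := @quad_free4 F a b
  (mquad M (w 0) - a * b * mquad M (w 2))
  (mpol M (w 0) (w 1) - a * (mquad M (w 2) + b * mpol M (w 2) (w 4)))
  (mquad M (w 1) + mpol M (w 0) (w 3) -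
        a * (mquad M (w 2) + mpol M (w 2) (w 4) + b * mquad M (w 4)))
  (mpol M (w 1) (w 3) - a * (mpol M (w 2) (w 4) + mquad M (w 4)))
  (mquad M (w 3) - a * mquad M (w 4))
  (mpol M (w 0) (w 2)) (mpol M (w 1) (w 2) + mpol M (w 0) (w 4))
  (mpol M (w 1) (w 4) + mpol M (w 2) (w 3)) (mpol M (w 3) (w 4)).
  rewrite -[RHS]e !mpolE !mquad_map !mpol_map.
  set q2 := mquad M (w 2); set q4 := mquad M (w 4); set p24 := mpol M (w 2) (w 4).
  transitivity (kc (mquad M (w 0)) + kx * kc (mpol M (w 0) (w 1))
    + kx ^+ 2 * kc (mquad M (w 1)) + kx ^+ 2 * kc (mpol M (w 0) (w 3))
    + kx ^+ 3 * kc (mpol M (w 1) (w 3)) + kx ^+ 4 * kc (mquad M (w 3))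
    + (kc (mpol M (w 0) (w 2)) + kx * (kc (mpol M (w 1) (w 2)) + kc (mpol M (w 0) (w 4)))
      + kx ^+ 2 * (kc (mpol M (w 1) (w 4)) + kc (mpol M (w 2) (w 3)))
      + kx ^+ 3 * kc (mpol M (w 3) (w 4))) * kz
    + Z2 * (kc q2 + kx * kc p24 + kx ^+ 2 * kc q4)).
    by rewrite EZ; ring.
  by rewrite /Z2; ring.
move=> [/eqP e0 /eqP e1 /eqP e2 /eqP e3 /eqP e4] [? ? ? ?].
by do 2?split=> //; apply/eqP; rewrite -subr_eq0.
Qed.

Definition contains_conic_form : Prop := exists u0 u1 u2 : 'rV[F]_d,
  [/\ mquad M u0 = a * b * mquad M u2, mquad M u1 = a * mquad M u2,
      mpol M u0 u1 = a * mquad M u2, mpol M u0 u2 = 0 & mpol M u1 u2 = 0] /\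
  mquad M u2 != 0.

Definition isotropic_in_degree2 : Prop := exists w : 'I_5 -> 'rV[F]_d,
  row_free (\matrix_k w k) /\ mquad MA (row2 w) = 0.

(** Induction on the degree.  Degree 0 contradicts anisotropy and degree 1 gives the
    first branch.  In degree 2 either the five coefficient vectors are independent, or
    the coordinates lie in a hyperplane of the space of elements of degree at most 2
    and descent applies.  In degree at least 3 the at most five coordinates are few
    enough for descent. *)
Lemma isotropic_deg_le n (v : 'rV[A]_d) : (d <= 5)%N ->
  v != 0 -> mquad MA v = 0 -> (forall i, qdeg (v 0 i)%R <= n)%N ->
  contains_conic_form \/ isotropic_in_degree2.
Proof.
move=> d5; elim: n v => [|[|[|n]] IH] v v0 qv dv.
- have [] := eqVneq v 0; first by move=> e; rewrite e eqxx in v0.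
  have [w e] : exists w : 'rV[F]_d, v = map_mx kc w.
    exists (\row_i ((v 0 i).1)`_0); apply/rowP => i; rewrite !mxE.
    by have [c ->] := qdeg0P (dv i); rewrite coef_kc1.
  move: qv; rewrite e mquad_map => /eqP; rewrite kc_eq0 => /eqP/M_anis ->.
  by rewrite map_mx0 eqxx.
- have [|w [vE]] := @row2_decomp v; first by move=> i; rewrite (leq_trans (dv i)).
  move=> /(_ dv)[w3 w4]; left; exists (w 0), (w 1), (w 2).
  rewrite vE in qv v0; have := mquad_row2 qv; rewrite w3 w4.
  have p0 x : mpol M x 0 = 0 by rewrite -(scale0r 0) mpolZr mul0r.
  rewrite !p0 !mquad0 !(mulr0, addr0) => -[[e0 e1 e2 _ _] [e3 e4 _ _]]; split=> //.
  apply: contraNneq v0 => q2; rewrite q2 !mulr0 in e0 e2.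
  rewrite row2E w3 w4 (M_anis e0) (M_anis e2) (M_anis q2).
  by rewrite !map_mx0 !scaler0 !addr0.
- have [w [vE _]] := row2_decomp dv.
  have [free|] := boolP (row_free (\matrix_k w k)).
    by right; exists w; rewrite -vE.
  rewrite -kermx_eq0 => /rowV0Pn[xi /sub_kermxP xi0 /rV0Pn[k xik]].
  (* eliminate the monomial k by the relation xi; its own term becomes zero *)
  have viE i : v 0 i = \sum_j kc (w j 0 i) * (mon2 j - kc (xi 0 j / xi 0 k) * mon2 k).
    have e0 : \sum_j xi 0 j * w j 0 i = 0.
      have /rowP/(_ i) := xi0; rewrite !mxE => e; rewrite -[RHS]e.
      by apply: eq_bigr => j _; rewrite mxE.
    rewrite (eq_bigr _ (fun j _ => mulrBr _ _ _)) sumrB.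
    rewrite [X in _ - X](_ : _ = 0) ?subr0.
      by rewrite vE summxE; apply: eq_bigr => j _; rewrite !mxE mulrC.
    transitivity (kc ((\sum_j xi 0 j * w j 0 i) / xi 0 k) * mon2 k); last first.
      by rewrite e0 mul0r rmorph0 mul0r.
    rewrite mulr_suml rmorph_sum mulr_suml; apply: eq_bigr => j _; rewrite /=; ring.
  (* j0 is one of x^2 and xz other than k, so that g j0 keeps degree 2 *)
  pose j0 : 'I_5 := if k == 3 :> nat then 4 else 3.
  have j0k : k != j0.
    by rewrite /j0; case: (k =P 3 :> nat) => [e|ne];
      rewrite -val_eqE /= ?e //; apply/eqP.
  have [j1 j1E _] := unlift_some j0k.
  pose g j := mon2 j - kc (xi 0 j / xi 0 k) * mon2 k.
  have dg j : (qdeg (g j) <= 2)%N by rewrite qdegB_le ?mon2_deg // qdeg_kcM ?mon2_deg.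
  have dg0 : qdeg (g j0) = 2%N.
    apply/eqP; rewrite eqn_leq dg ltnNge qdeg_le; apply/negP => /andP[s1 s2].
    have : ((g j0).1)`_2 = 0 by rewrite nth_default.
    have : ((g j0).2)`_1 = 0 by rewrite nth_default.
    rewrite coefD1 coefD2 coefN1 coefN2 coef_kcM1 coef_kcM2 !mon2_lead1 !mon2_lead2.
    rewrite /j0; case: (k =P 3 :> nat) => [->|] /=.
      by rewrite mulr0 subr0 => /eqP; rewrite oner_eq0.
    by move=> _ _; rewrite mulr0 subr0 => /eqP; rewrite oner_eq0.
  have [|v' [v'0 qv' dv']] := @descent F a b conic_anis 1 3 d M v (g j0)
    (fun j => g (lift k (lift j1 j))) (fun i => w j0 0 i)
    (fun i j => w (lift k (lift j1 j)) 0 i) isT dg0 (fun j => dg _) _ v0 qv.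
    move=> i; rewrite viE (bigD1_ord k) //= divff // rmorph1 mul1r subrr mulr0 add0r.
    by rewrite (bigD1_ord j1) //= -j1E.
  exact: IH v'0 qv' dv'.
have [|||v' [v'0 qv' dv']] := @descent F a b conic_anis n.+2 d d M v (kx ^+ n.+3)
  (fun j => v 0 j) (fun=> 0) (fun i j => (i == j)%:R) _ _ dv _ v0 qv.
- by rewrite (leq_trans d5) //; lia.
- by rewrite /quad_x -rmorphXn /qdeg /= size_polyXn size_poly0 maxn0.
- move=> i; rewrite rmorph0 mul0r add0r (bigD1 i) //= eqxx rmorph1 mul1r big1 ?addr0 //.
  by move=> j ne; rewrite eq_sym (negPf ne) rmorph0 mul0r.
exact: IH v'0 qv' dv'.
Qed.
End Form.
End LowDegree.

(** * From the function field to the conic ring *)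

Lemma mpoly_morph_eq (F : fieldType) (K : comNzRingType) n (f g : {rmorphism {mpoly F[n]} -> K}) :
  (forall c, f c%:MP = g c%:MP) -> (forall i, f 'X_i = g 'X_i) -> f =1 g.
Proof.
move=> fgC fgX p; rewrite [p]mpolyE !rmorph_sum; apply: eq_bigr => m _ /=.
rewrite -mul_mpolyC !rmorphM fgC; congr (_ * _).
by rewrite mpolyXE_id !rmorph_prod; apply: eq_bigr => i _; rewrite !rmorphXn fgX.
Qed.

Lemma ord3_case (P : 'I_3 -> Prop) : P (inord 0) -> P (inord 1) -> P (inord 2) ->
  forall i, P i.
Proof.
move=> p0 p1 p2 i.
have [e|e|e] : [\/ i = inord 0, i = inord 1 | i = inord 2]; last 1 first.
- by rewrite e.
- case: i => -[|[|[|//]]] h; [apply: Or31|apply: Or32|apply: Or33];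
    by apply: val_inj; rewrite /= inordK.
- by rewrite e.
by rewrite e.
Qed.

Section GenericPoint.
Variables (F : fieldType) (a b : F) (K : fieldType) (iota : {rmorphism F -> K}).
Local Notation A := (quad (conic_poly a b)).
Local Notation kc := (@quad_const F a b).
Local Notation kx := (@quad_x F a b).
Local Notation kz := (@quad_z F a b).
Local Notation S := {mpoly F[3]}.

Section Spec.
Variables x z : K.
Hypothesis zz : z ^+ 2 = - (iota a * (x ^+ 2 + x + iota b)).
Definition quad_eval (f : A) : K :=
  (map_poly iota f.1).[x] + (map_poly iota f.2).[x] * z.
Lemma conic_eval : (map_poly iota (conic_poly a b)).[x] = z ^+ 2.
Proof.
rewrite zz /conic_poly !expr2 !(rmorphN, rmorphM, rmorphD) /= !map_polyX !map_polyC.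
by rewrite !(hornerN, hornerM, hornerD, hornerC, hornerX).
Qed.
Fact quad_eval_zmod : zmod_morphism quad_eval.
Proof. by move=> f g; rewrite /quad_eval !rmorphB /= !hornerD !hornerN; ring. Qed.
Fact quad_eval_monoid : monoid_morphism quad_eval.
Proof.
split=> [|f g]; rewrite /quad_eval.
  by rewrite rmorph1 rmorph0 hornerC horner0 mul0r addr0.
rewrite quadM1 quadM2 !(rmorphD, rmorphM) /= !(hornerD, hornerM) conic_eval; ring.
Qed.
Definition quad_spec : {rmorphism A -> K} :=
  HB.pack quad_eval (GRing.isZmodMorphism.Build A K quad_eval quad_eval_zmod)
    (GRing.isMonoidMorphism.Build A K quad_eval quad_eval_monoid).
Lemma quad_spec_kc c : quad_spec (kc c) = iota c.
Proof. by rewrite /= /quad_eval /= map_polyC hornerC rmorph0 horner0 mul0r addr0. Qed.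
Lemma quad_spec_kx : quad_spec kx = x.
Proof. by rewrite /= /quad_eval /= map_polyX hornerX rmorph0 horner0 mul0r addr0. Qed.
Lemma quad_spec_kz : quad_spec kz = z.
Proof. by rewrite /= /quad_eval /= rmorph0 horner0 add0r rmorph1 hornerC mul1r. Qed.
End Spec.

(** The homogeneous coordinates (xT, T, zT) on the cone over the conic. *)
Definition coneX (i : 'I_3) : {poly A} :=
  if i == inord 0 then kx%:P * 'X else if i == inord 1 then 'X else kz%:P * 'X.
Definition coneT : S -> {poly A} := mmap (polyC \o kc) coneX.
HB.instance Definition _ := GRing.RMorphism.on coneT.

Lemma coneT_C c : coneT c%:MP = (kc c)%:P.
Proof. exact: mmapC. Qed.
Lemma coneT_X i : coneT 'X_i = coneX i.
Proof. by rewrite /coneT mmapX mmap1U. Qed.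

Lemma inord3_neq (i j : nat) : (i < 3)%N -> (j < 3)%N ->
  ((inord i : 'I_3) == inord j) = (i == j).
Proof. by move=> hi hj; rewrite -val_eqE /= !inordK. Qed.

Lemma coneX0 : coneX (inord 0) = kx%:P * 'X.
Proof. by rewrite /coneX eqxx. Qed.
Lemma coneX1 : coneX (inord 1) = 'X.
Proof. by rewrite /coneX inord3_neq // eqxx. Qed.
Lemma coneX2 : coneX (inord 2) = kz%:P * 'X.
Proof. by rewrite /coneX !inord3_neq. Qed.

Lemma coneT_tau : coneT (tau_poly a b) = 0.
Proof.
rewrite /tau_poly !(rmorphD, rmorphM, rmorphXn) /= !coneT_C !coneT_X coneX0 coneX1 coneX2.
transitivity ((kz%:P ^+ 2 + (kc a)%:P * (kx%:P ^+ 2 + kx%:P + (kc b)%:P)) * 'X^2 : {poly A}).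
  by ring.
by rewrite -rmorphXn kz2 -!(rmorphD, rmorphM, rmorphXn) /= addNr mul0r.
Qed.

Section Generic.
Variable ev : {rmorphism S -> K}.
Hypothesis evC : forall c, ev c%:MP = iota c.
Hypothesis evker : forall p, ev p = 0 <-> exists q, p = q * tau_poly a b.

Lemma ev_neq0 p : coneT p != 0 -> ev p != 0.
Proof.
apply: contraNneq => /evker[q ->]; by rewrite rmorphM /= coneT_tau mulr0.
Qed.

Local Notation X0 := (ev 'X_(inord 0)).
Local Notation X1 := (ev 'X_(inord 1)).
Local Notation X2 := (ev 'X_(inord 2)).

Lemma ev_X1 : X1 != 0.
Proof. by rewrite ev_neq0 // coneT_X coneX1 polyX_eq0. Qed.
Lemma ev_X2 : X2 != 0.
Proof.
have kz0 : kz != 0 by apply/eqP => e; have := qdeg_kz a b; rewrite e qdeg0.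
have c1 : (kz%:P * 'X : {poly A})`_1 = kz by rewrite coefCM coefX mulr1.
rewrite ev_neq0 // coneT_X coneX2; apply: contraNneq kz0 => e.
by rewrite -c1 e coef0.
Qed.

Lemma ev_conic : iota a * (X0 ^+ 2 + X0 * X1 + iota b * X1 ^+ 2) + X2 ^+ 2 = 0.
Proof.
transitivity (ev (tau_poly a b)).
  by rewrite /tau_poly !(rmorphD, rmorphM, rmorphXn) /= !evC.
by apply/evker; exists 1; rewrite mul1r.
Qed.

Lemma ev_affine : (X2 / X1) ^+ 2 =
  - (iota a * ((X0 / X1) ^+ 2 + X0 / X1 + iota b)).
Proof.
apply/eqP; rewrite -addr_eq0; apply/eqP.
rewrite -[RHS](mul0r (X1 ^- 2)) -ev_conic; field; exact: ev_X1.
Qed.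

(** Sending x, z, T to X/Y, Z/Y, Y turns the coordinates (xT, T, zT) back into
    (X, Y, Z), so evaluation in the function field factors through A[T]. *)
Lemma ev_factor p : coneT p = 0 -> ev p = 0.
Proof.
pose th := quad_spec ev_affine.
have cX : commr_rmorph th X1 by move=> f; apply: mulrC.
have hm f : horner_morph cX (f%:P * 'X) = th f * X1.
  transitivity ((map_poly th f%:P * map_poly th 'X).[X1]); first by rewrite -rmorphM.
  by rewrite map_polyC map_polyX hornerM hornerC hornerX.
have E : ev =1 horner_morph cX \o coneT.
  apply: mpoly_morph_eq => [c|].
    by rewrite -[RHS]/(horner_morph cX (coneT _)) coneT_C horner_morphC quad_spec_kc evC.
  have X1u := ev_X1.
  apply: ord3_case; rewrite -[RHS]/(horner_morph cX (coneT _)) coneT_X.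
  - by rewrite coneX0 hm quad_spec_kx divfK.
  - by rewrite coneX1 horner_morphX.
  by rewrite coneX2 hm quad_spec_kz divfK.
by move=> e; rewrite E -[LHS]/(horner_morph cX (coneT p)) e rmorph0.
Qed.

Hypothesis evfrac : forall k : K, exists p q, ev q != 0 /\ k = ev p / ev q.

Lemma common_denominator d (x : 'rV[K]_d) :
  exists (p : 'rV[S]_d) q, ev q != 0 /\ map_mx ev p = ev q *: x.
Proof.
have [f fP] : exists f : 'I_d -> S * S, forall i,
    ev (f i).2 != 0 /\ x 0 i = ev (f i).1 / ev (f i).2.
  apply: (@fin_all_exists _ _ (fun i pq => ev pq.2 != 0 /\ x 0 i = ev pq.1 / ev pq.2)).
  by move=> i; have [p [q h]] := evfrac (x 0 i); exists (p, q).
exists (\row_i ((f i).1 * \prod_(j | j != i) (f j).2)), (\prod_j (f j).2).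
split; first by rewrite rmorph_prod; apply/prodf_neq0 => i _; case: (fP i).
apply/rowP => i; have [f2 e] := fP i; rewrite !mxE e [in RHS](bigD1 i) //= !rmorphM /=.
by field.
Qed.

(** Clear denominators, carry the polynomial vector to A[T] by coneT, where it stays
    nonzero by ev_factor, and take the coefficient of the highest power of T. *)
Lemma isotropic_over_ring d (M : 'M[F]_d) (x : 'rV[K]_d) :
  x != 0 -> mquad (map_mx iota M) x = 0 ->
  exists v : 'rV[A]_d, v != 0 /\ mquad (map_mx kc M) v = 0.
Proof.
move=> x0 qx; have [p [q [q0 pE]]] := common_denominator x.
pose MS := map_mx (@mpolyC 3 F) M.
have MSK : map_mx ev MS = map_mx iota M by apply/matrixP => i j; rewrite !mxE evC.
have MST : map_mx coneT MS = map_mx polyC (map_mx kc M).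
  by apply/matrixP => i j; rewrite !mxE coneT_C.
have [r rE] : exists r, mquad MS p = r * tau_poly a b.
  by apply/evker; rewrite -mquad_map MSK pE mquadZ qx mulr0.
pose u := map_mx coneT p.
have qu : mquad (map_mx polyC (map_mx kc M)) u = 0.
  by rewrite -MST mquad_map rE rmorphM /= coneT_tau mulr0.
have u0 : u != 0.
  apply: contraNneq x0 => u0; have : map_mx ev p = 0.
    apply/rowP => i; rewrite !mxE; apply: ev_factor.
    by have /rowP/(_ i) := u0; rewrite !mxE.
  by rewrite pE => /eqP; rewrite scaler_eq0 (negPf q0).
clearbody u; have [i0 ui0] := rV0Pn _ u0.
pose s (i : 'I_d) := size (u 0 i).
have [|i1 _ s1] := @eq_bigmax_cond _ predT s; first by rewrite (cardD1 i0).
have sle i : (s i <= s i1)%N by rewrite -s1 leq_bigmax_cond.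
have s_gt0 : (0 < s i1)%N by rewrite (leq_trans _ (sle i0)) // size_poly_gt0.
pose m := (s i1).-1.
have ei1 : m.+1 = size (u 0 i1) by rewrite prednK.
have sz i : (size (u 0 i)%R <= m.+1)%N by rewrite ei1; apply: sle.
exists (\row_i (u 0 i)`_m); split.
  apply/eqP => /rowP/(_ i1); rewrite [LHS]mxE [RHS]mxE => e.
  have : lead_coef (u 0 i1) = 0 by rewrite lead_coefE -ei1 e.
  by move/eqP; rewrite lead_coef_eq0 -size_poly_eq0 -ei1.
transitivity ((mquad (map_mx polyC (map_mx kc M)) u)`_(m + m)); last by rewrite qu coef0.
rewrite /mquad !mbil_sum coef_sum; apply: eq_bigr => i _.
rewrite coef_sum; apply: eq_bigr => j _.
by rewrite !mxE coefCM coefM_top.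
Qed.
End Generic.
End GenericPoint.

(** * The relations in degree two *)

(** Over a ring of characteristic 2 the two sides of an identity may differ by a
    multiple of 2; the witness z is half of that difference, computed over Z. *)
Lemma eq_char2 (R : comNzRingType) (x y z : R) : 2 = 0 :> R -> x - y = 2 * z -> x = y.
Proof. by move=> -> /eqP; rewrite mul0r subr_eq0 => /eqP. Qed.

(** The p_i and B_ij are the values and polar values on five vectors v_i such that
    v_0 + v_1 x + v_2 t + v_3 xt + v_4 t^2 is isotropic, where x^2 = x + b + a t^2
    is the conic with t = z / a.  R1 to R9 compare coefficients, and the P's are
    Pfaffians. *)
Section Degree2Relations.
Variables (F : fieldType) (two0 : 2 = 0 :> F) (a b : F).
Variables p0 p1 p2 p3 p4 B01 B02 B03 B04 B12 B13 B14 B23 B24 B34 : F.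
Hypotheses (R1 : p0 = b * p1) (R2 : B01 = p1) (R3 : B02 = b * B13)
  (R4 : B03 = B12 + B13) (R5 : p2 = a * p1 + b * p3 + B04) (R6 : p3 = B14 + B23)
  (R7 : B24 = a * B13) (R8 : B34 = 0) (R9 : p4 = a * p3).
Hypotheses (P0123 : B01 * B23 + B02 * B13 + B03 * B12 = 0)
  (P0134 : B01 * B34 + B03 * B14 + B04 * B13 = 0)
  (P1234 : B12 * B34 + B13 * B24 + B14 * B23 = 0).
Hypothesis anis : forall c0 c1 c2 c3 c4,
  p0 * c0 ^+ 2 + p1 * c1 ^+ 2 + p2 * c2 ^+ 2 + p3 * c3 ^+ 2 + p4 * c4 ^+ 2 +
  (B01 * (c0 * c1) + B02 * (c0 * c2) + B03 * (c0 * c3) + B04 * (c0 * c4) +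
   B12 * (c1 * c2) + B13 * (c1 * c3) + B14 * (c1 * c4) + B23 * (c2 * c3) +
   B24 * (c2 * c4) + B34 * (c3 * c4)) = 0 ->
  [/\ c0 = 0, c1 = 0, c2 = 0, c3 = 0 & c4 = 0].

(** Otherwise v_1 and v_3 span a nonsingular plane, and projecting v_2 and v_4 along it
    gives two radical vectors whose values differ by a square factor.  The coefficients
    c1, c2, c3, B13^2 are those of the isotropic combination of the two. *)
Lemma degree2_B13 : B13 = 0.
Proof.
pose c1 := (B14 + B23) * B23; pose c2 := (B14 + B23) * B13.
pose c3 := B13 * B14 + (B14 + B23) * B12.
have [|_ _ _ _ /eqP] := @anis 0 c1 c2 c3 (B13 ^+ 2); last first.
  by rewrite expf_eq0 => /andP[_ /eqP].
transitivity ((B14 + B23) ^+ 2 * B01 * (B12 * B34 + B13 * B24 + B14 * B23) +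
  (B14 + B23) ^+ 3 * (B01 * B23 + B02 * B13 + B03 * B12) +
  B13 * (B14 + B23) ^+ 2 * (B01 * B34 + B03 * B14 + B04 * B13)).
  apply: (eq_char2 (z := - B01 * B14 * B23 ^+ 3 - 2 * B01 * B14 ^+ 2 * B23 ^+ 2
    - B01 * B14 ^+ 3 * B23 + 2 * B12 * B13 * B14 * B23 ^+ 2
    + B12 * B13 * B14 ^+ 2 * B23 + B12 * B13 * B23 ^+ 3 + B13 ^+ 2 * B14 * B23 ^+ 2
    + B13 ^+ 2 * B14 ^+ 2 * B23 + B13 ^+ 4 * B14 * a + B13 ^+ 4 * B23 * a) two0).
  by rewrite R9 R5 R6 R4 R1 R3 R7 R8 -R2 /c1 /c2 /c3; ring.
by rewrite P1234 P0123 P0134; ring.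
Qed.

Lemma degree2_shape :
  [/\ B02 = 0, B03 = 0, B12 = 0, B13 = 0 & [/\ B23 = 0, B24 = 0 & B34 = 0]] /\
  [/\ p3 = B14, B14 != 0 & p2 * p3 + B04 ^+ 2 != 0].
Proof.
have m0 := degree2_B13.
have p30 : p3 != 0.
  apply/eqP => p30; have [|_ _ _ /eqP] := @anis 0 0 0 1 0; last by rewrite oner_eq0.
  by rewrite p30; ring.
have n14 : B14 != 0.
  apply: contraNneq p30 => p0'; rewrite R6 p0' add0r.
  have [|_ -> //] := @anis 0 B23 0 B12 0.
  transitivity (B23 * (B01 * B23 + B02 * B13 + B03 * B12)); last by rewrite P0123 mulr0.
  by rewrite R6 R4 p0' m0 R3 R2 m0; ring.
have r0 : B23 = 0.
  move: P1234; rewrite m0 R8 mulr0 mul0r !add0r => /eqP.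
  by rewrite mulf_eq0 (negPf n14) => /eqP.
have q0 : B12 = 0.
  move: P0134; rewrite R4 m0 R8 !mulr0 add0r !addr0 => /eqP.
  by rewrite mulf_eq0 (negPf n14) orbF => /eqP.
have e3 : p3 = B14 by rewrite R6 r0 addr0.
split; first by rewrite R3 R4 R7 R8 q0 m0 r0 !mulr0 addr0.
split=> //; apply: contraNneq p30 => s0.
have [|_ _ -> //] := @anis 0 0 p3 B04 0.
transitivity (p3 * (p2 * p3 + B04 ^+ 2)); last by rewrite s0 mulr0.
by rewrite r0; ring.
Qed.
End Degree2Relations.

Section Free5.
Variables (F : fieldType) (d : nat).
Definition free5 (v0 v1 v2 v3 v4 : 'rV[F]_d) := forall c0 c1 c2 c3 c4 : F,
  c0 *: v0 + c1 *: v1 + c2 *: v2 + c3 *: v3 + c4 *: v4 = 0 ->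
  [/\ c0 = 0, c1 = 0, c2 = 0, c3 = 0 & c4 = 0].

Lemma mulmx_rows5 (c : 'rV[F]_5) (w : 'I_5 -> 'rV[F]_d) :
  c *m \matrix_k w k = c 0 0 *: w 0 + c 0 1 *: w 1 + c 0 2 *: w 2 + c 0 3 *: w 3
    + c 0 4 *: w 4.
Proof. by rewrite mulmx_sum_row big_ord5 !rowK. Qed.

Lemma free5P (w : 'I_5 -> 'rV[F]_d) :
  row_free (\matrix_k w k) <-> free5 (w 0) (w 1) (w 2) (w 3) (w 4).
Proof.
split=> [/row_freeP[W' wW'] c0 c1 c2 c3 c4 e|fr].
  pose c : 'rV[F]_5 := \row_k nth 0 [:: c0; c1; c2; c3; c4] k.
  have c0E : c = 0.
    rewrite -[c]mulmx1 -wW' mulmxA mulmx_rows5 !mxE /= e mul0mx //.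
  have cE k : c 0 k = 0 by rewrite c0E mxE.
  by split; [have := cE 0|have := cE 1|have := cE 2|have := cE 3|have := cE 4];
    rewrite mxE.
rewrite -kermx_eq0; apply/rowV0P => c /sub_kermxP; rewrite mulmx_rows5.
move/fr => -[e0 e1 e2 e3 e4]; apply/rowP => k; rewrite mxE.
have : k \in [:: 0; 1; 2; 3; 4 : 'I_5] by case: k => -[|[|[|[|[|//]]]]] ?; rewrite !inE -!val_eqE.
by rewrite !inE => /or4P[/eqP->|/eqP->|/eqP->|/orP[]/eqP->].
Qed.
End Free5.

Lemma mquad5 (F : fieldType) d (M : 'M[F]_d) v0 v1 v2 v3 v4 c0 c1 c2 c3 c4 :
  mquad M (c0 *: v0 + c1 *: v1 + c2 *: v2 + c3 *: v3 + c4 *: v4) =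
  mquad M v0 * c0 ^+ 2 + mquad M v1 * c1 ^+ 2 + mquad M v2 * c2 ^+ 2
  + mquad M v3 * c3 ^+ 2 + mquad M v4 * c4 ^+ 2 +
  (mpol M v0 v1 * (c0 * c1) + mpol M v0 v2 * (c0 * c2) + mpol M v0 v3 * (c0 * c3)
   + mpol M v0 v4 * (c0 * c4) + mpol M v1 v2 * (c1 * c2) + mpol M v1 v3 * (c1 * c3)
   + mpol M v1 v4 * (c1 * c4) + mpol M v2 v3 * (c2 * c3) + mpol M v2 v4 * (c2 * c4)
   + mpol M v3 v4 * (c3 * c4)).
Proof. by rewrite !mpolE; ring. Qed.

Section Degree2NormalForm.
Variables (F : fieldType) (a b : F) (two0 : 2 = 0 :> F).
Hypothesis conic_anis : forall x y z : F,
  a * (x ^+ 2 + x * y + b * y ^+ 2) + z ^+ 2 = 0 -> [/\ x = 0, y = 0 & z = 0].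
Variables (d : nat) (M : 'M[F]_d).
Hypothesis M_anis : forall x, mquad M x = 0 -> x = 0.
Variables f h : 'rV[F]_d -> F.
Hypothesis rank2 : forall x y, mpol M x y = f x * h y + f y * h x.

(** An alternating form of rank 2 is decomposable, so these are Pluecker relations. *)
Lemma pfaffian0 x y z t :
  mpol M x y * mpol M z t + mpol M x z * mpol M y t + mpol M x t * mpol M y z = 0.
Proof.
apply: (eq_char2 (z := f x * f y * h z * h t + f x * f z * h y * h t + f x * f t * h y * h z
  + f y * f z * h x * h t + f y * f t * h x * h z + f z * f t * h x * h y) two0).
by rewrite !rank2; ring.
Qed.

Lemma a_neq0 : a != 0.
Proof.
apply/eqP => a0; have [|/eqP] := @conic_anis 1 0 0; last by rewrite oner_eq0.
by rewrite a0; ring.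
Qed.

(** Substituting x^2 = x + b + a t^2 and z = a t in the decomposition of the isotropic
    vector along 1, x, z, x^2, xz gives its coefficients along 1, x, t, xt, t^2, to
    which degree2_shape applies.  In the notation used there, p = B14,
    l = B04 / p and m = B01 / p. *)
Lemma degree2_normal_form : isotropic_in_degree2 a b M ->
  exists (v0 v1 v2 v3 v4 : 'rV[F]_d) (p l m : F),
  [/\ free5 v0 v1 v2 v3 v4, p != 0, l ^+ 2 + l + b + a * m != 0
    & forall c0 c1 c2 c3 c4,
      mquad M (c0 *: v0 + c1 *: v1 + c2 *: v2 + c3 *: v3 + c4 *: v4) =
      p * (b * m * c0 ^+ 2 + m * c1 ^+ 2 + (l + b + a * m) * c2 ^+ 2 + c3 ^+ 2
           + a * c4 ^+ 2 + m * (c0 * c1) + l * (c0 * c4) + c1 * c4)].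
Proof.
move=> [w [/free5P wfree /(mquad_row2)]].
set w0 := w 0; set w1 := w 1; set w2 := w 2; set w3 := w 3; set w4 := w 4.
move=> [[P0 B01 E1 B13 P3] [B02 E12 E14 B34]].
have P1 : mquad M w1 = a * (mquad M w2 + mpol M w2 w4 + b * mquad M w4) - mpol M w0 w3.
  by rewrite -E1; ring.
have B12 : mpol M w1 w2 = - mpol M w0 w4 by apply/eqP; rewrite -addr_eq0 E12.
have B14 : mpol M w1 w4 = - mpol M w2 w3 by apply/eqP; rewrite -addr_eq0 E14.
have a0 := a_neq0.
pose v0 := w0 + b *: w3; pose v1 := w1 + w3; pose v2 := a *: w2.
pose v3 := a *: w4; pose v4 := a *: w3.
have vfree : free5 v0 v1 v2 v3 v4.
  move=> c0 c1 c2 c3 c4 e.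
  have [|-> -> /eqP c2a + /eqP c3a] :=
    @wfree c0 c1 (a * c2) (b * c0 + c1 + a * c4) (a * c3).
    rewrite -[RHS]e /v0 /v1 /v2 /v3 /v4 !scalerDr !scalerDl !scalerA.
    by apply/rowP => i; rewrite !mxE; ring.
  rewrite mulr0 !add0r => /eqP; move: c2a c3a.
  by rewrite !mulf_eq0 (negPf a0) /= => /eqP -> /eqP -> /eqP ->.
have expand : [/\ mquad M v0 = mquad M w0 + b ^+ 2 * mquad M w3 + b * mpol M w0 w3,
  mquad M v1 = mquad M w1 + mquad M w3 + mpol M w1 w3, mquad M v2 = a ^+ 2 * mquad M w2,
  mquad M v3 = a ^+ 2 * mquad M w4 & mquad M v4 = a ^+ 2 * mquad M w3].
  by rewrite /v0 /v1 /v2 /v3 /v4 !mpolE; split; ring.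
move: expand => [q0 q1 q2 q3 q4].
have sym := (mpolC M w1 w0, mpolC M w2 w0, mpolC M w3 w0, mpolC M w4 w0,
  mpolC M w2 w1, mpolC M w3 w1, mpolC M w4 w1, mpolC M w3 w2, mpolC M w4 w2, mpolC M w4 w3).
pose b03 := mpol M w0 w3; pose b24 := mpol M w2 w4; pose f4 := mquad M w4.
pose b23 := mpol M w2 w3; pose b04 := mpol M w0 w4.
have solve := (P0, P1, P3, B01, B13, B02, B12, B14, B34).
have R1 : mquad M v0 = b * mquad M v1.
  apply: (eq_char2 (z := b03 * b - b24 * a * b - f4 * a * b) two0).
  by rewrite q0 q1 !solve -/b03 -/b24 -/f4; ring.
have R2 : mpol M v0 v1 = mquad M v1.
  apply: (eq_char2 (z := b03 - b24 * a + b24 * a * b - f4 * a + f4 * a * b) two0).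
  by rewrite q1 /v0 /v1 !mpolE ?sym !solve -/b03 -/b24 -/f4; ring.
have R3 : mpol M v0 v2 = b * mpol M v1 v3.
  apply: (eq_char2 (z := b23 * a * b) two0).
  by rewrite /v0 /v1 /v2 /v3 !mpolE ?sym !solve -/b23; ring.
have R4 : mpol M v0 v3 = mpol M v1 v2 + mpol M v1 v3.
  apply: (eq_char2 (z := b04 * a) two0).
  by rewrite /v0 /v1 /v2 /v3 !mpolE ?sym !solve -/b04; ring.
have R5 : mquad M v2 = a * mquad M v1 + b * mquad M v3 + mpol M v0 v4.
  apply: (eq_char2 (z := - b24 * a ^+ 2 - f4 * a ^+ 2 - 2 * f4 * a ^+ 2 * b) two0).
  by rewrite q1 q2 q3 /v0 /v4 !mpolE ?sym !solve -/b03 -/b24 -/f4; ring.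
have R6 : mquad M v3 = mpol M v1 v4 + mpol M v2 v3.
  apply: (eq_char2 (z := - b24 * a ^+ 2 - f4 * a ^+ 2) two0).
  by rewrite q3 /v1 /v2 /v3 /v4 !mpolE ?sym !solve -/b24 -/f4; ring.
have R7 : mpol M v2 v4 = a * mpol M v1 v3.
  apply: (eq_char2 (z := b23 * a ^+ 2) two0).
  by rewrite /v1 /v2 /v3 /v4 !mpolE ?sym !solve -/b23; ring.
have R8 : mpol M v3 v4 = 0 by rewrite /v3 /v4 !mpolE ?sym !solve; ring.
have R9 : mquad M v4 = a * mquad M v3 by rewrite q3 q4 !solve; ring.
have [|[z02 z03 z12 z13 [z23 z24 z34]] [e3 n14 s0]] :=
    degree2_shape two0 R1 R2 R3 R4 R5 R6 R7 R8 R9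
      (pfaffian0 _ _ _ _) (pfaffian0 _ _ _ _) (pfaffian0 _ _ _ _).
  by move=> c0 c1 c2 c3 c4 e; apply: vfree; apply: M_anis; rewrite mquad5.
rewrite e3 in R5 s0 R9.
exists v0, v1, v2, v3, v4, (mpol M v1 v4), (mpol M v0 v4 / mpol M v1 v4).
exists (mquad M v1 / mpol M v1 v4); split=> //.
  apply: contraNneq s0 => s0; apply/eqP.
  rewrite -[RHS](mulr0 (mpol M v1 v4 ^+ 2)) -s0 R5; field; exact: n14.
move=> c0 c1 c2 c3 c4.
by rewrite mquad5 z02 z03 z12 z13 z23 z24 z34 R2 R1 R5 R9 e3; field.
Qed.
End Degree2NormalForm.

(** * Isometries, radicals and quasilinear parts *)

Section Isometries.
Variable F : fieldType.

Lemma linear_inverse (U V : lmodType F) (f : {linear U -> V}) : bijective f ->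
  exists g : {linear V -> U}, cancel f g /\ cancel g f.
Proof.
case=> g fK gK.
have gP : linear g by move=> c u v; apply: (can_inj fK); rewrite linearP !gK.
by exists (HB.pack_for {linear V -> U} g (GRing.isLinear.Build F V U _ g gP)).
Qed.

Lemma isometric_refl (phi : qform F) : isometric phi phi.
Proof. by exists idfun; split=> //; exists idfun. Qed.

Lemma polar_isometry (phi psi : qform F) (f : {linear qspace phi -> qspace psi}) :
  (forall v, phi v = psi (f v)) ->
  forall v w, polar phi v w = polar psi (f v) (f w).
Proof. by move=> e v w; rewrite /polar !e linearD. Qed.

Lemma polar_qorth (phi psi : qform F) (v w : qspace (qorth phi psi)) :
  polar (qorth phi psi) v w = polar phi v.1 w.1 + polar psi v.2 w.2.
Proof. by rewrite /polar /=; ring. Qed.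

Lemma polar_q2 (a b : F) (v w : qspace (q2 a b)) : 2 = 0 :> F ->
  polar (q2 a b) v w = v.1 * w.2 + v.2 * w.1.
Proof.
move=> two0; apply: (eq_char2 (z := a * v.1 * w.1 + b * v.2 * w.2) two0).
by rewrite /polar /=; ring.
Qed.

Lemma polar_qdiag (cs : seq F) (v w : qspace (qdiag cs)) : 2 = 0 :> F ->
  polar (qdiag cs) v w = 0.
Proof.
move=> two0; elim: cs v w => [|c cs IH] v w; first by rewrite /polar /= !subr0.
rewrite (polar_qorth (phi := q1 c) (psi := qdiag cs)) IH addr0.
by apply: (eq_char2 (z := c * v.1 * w.1) two0); rewrite /polar /=; ring.
Qed.

Lemma qbin_nondegenerate (abs : seq (F * F)) (v : qspace (qbin abs)) : 2 = 0 :> F ->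
  (forall w, polar (qbin abs) v w = 0) -> v = 0.
Proof.
move=> two0; elim: abs v => [|[a b] abs IH] v vP; first exact: thinmx0.
case: v vP => [[x y] v] vP.
have polE := polar_qorth (phi := q2 a b) (psi := qbin abs).
have v0 : v = 0.
  apply: IH => w; have := vP (0, w); rewrite polE /=.
  by rewrite (@polar0r F (q2 a b)) add0r.
have x0 : x = 0.
  have := vP ((0, 1), 0); rewrite polE /= (@polar0r F (qbin abs)) addr0.
  by rewrite polar_q2 //= mulr1 mulr0 addr0.
have y0 : y = 0.
  have := vP ((1, 0), 0); rewrite polE /= (@polar0r F (qbin abs)) addr0.
  by rewrite polar_q2 //= mulr1 mulr0 add0r.
by rewrite v0 x0 y0.
Qed.

Lemma bijective_qdim (phi psi : qform F) (f : {linear qspace phi -> qspace psi}) :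
  bijective f -> qdim phi = qdim psi.
Proof.
have le (p q : qform F) (g : {linear qspace p -> qspace q}) : injective g ->
    (qdim p <= qdim q)%N.
  move=> gI; rewrite /qdim -(limg_ker_dim (linfun g)) capfv.
  have -> : lker (linfun g) = 0%VS.
    by apply/eqP/lker0P => u v; rewrite !lfunE => /gI.
  by rewrite dimv0 add0n dimvS // subvf.
move=> fb; have [g [fK gK]] := linear_inverse fb.
apply/eqP; rewrite eqn_leq (le _ _ f (can_inj fK)).
by rewrite (le _ _ g (can_inj gK)).
Qed.

Lemma anisotropic_injective (phi psi : qform F) (f : {linear qspace phi -> qspace psi}) :
  anisotropic phi -> (forall v, phi v = psi (f v)) -> injective f.
Proof.
move=> anis e; apply: raddf_inj => v fv0; apply/eqP; apply/negPn/negP => v0.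
by apply: anis; exists v; rewrite e fv0 qform0.
Qed.

Definition radical (phi : qform F) (r : qspace phi) := forall v, polar phi r v = 0.

(** The quasilinear part is the restriction of phi to its radical, whichever
    decomposition is used: the sum of the planes is nonsingular. *)
Lemma represents_ql (phi rho : qform F) (e : F) : 2 = 0 :> F -> is_ql phi rho ->
  represents rho e <-> e != 0 /\ exists r, radical r /\ phi r = e.
Proof.
move=> two0 [abs [cs [[f [fb fE]] [g [gb gE]]]]].
have [f' [fK f'K]] := linear_inverse fb; have [g' [gK g'K]] := linear_inverse gb.
split=> -[e0 H]; split=> //.
  case: H => v ve; exists (f' (0, g v)); split.
    move=> w; rewrite (polar_isometry fE) f'K polar_qorth /=.
    by rewrite (@polar0l F (qbin abs)) add0r polar_qdiag.
  by rewrite fE f'K /= (@qform0 F (qbin abs)) add0r -gE.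
case: H => r [rad re]; exists (g' (f r).2).
rewrite gE g'K -re fE /=.
have -> : (f r).1 = 0.
  apply: qbin_nondegenerate => // w; have := rad (f' (w, 0)).
  rewrite (polar_isometry fE) f'K polar_qorth /=.
  by rewrite (@polar0r F (qdiag cs)) addr0.
by rewrite (@qform0 F (qbin abs)) add0r.
Qed.

End Isometries.

Lemma combine2 (F : fieldType) (V : lmodType F) (c x y x' y' : F) (v w u1 u0 : V) :
  (c *: v + w) - ((c * x + x') *: u1 + (c * y + y') *: u0) =
  c *: (v - (x *: u1 + y *: u0)) + (w - (x' *: u1 + y' *: u0)).
Proof.
by rewrite !scalerDl -!scalerA scalerBr !scalerDr [X in _ - X]addrACA opprD addrACA.
Qed.

(** * Multiples of tau inside a form *)

Section ConicVectors.
Variables (F : fieldType) (a b : F) (two0 : 2 = 0 :> F).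
Hypothesis tau_anis : anisotropic (tau_form a b).

Lemma anisotropic_conic (x y z : F) :
  a * (x ^+ 2 + x * y + b * y ^+ 2) + z ^+ 2 = 0 -> [/\ x = 0, y = 0 & z = 0].
Proof.
move=> e; pose v : qspace (tau_form a b) := ((x, y), z).
have [v0|v0] := eqVneq v 0; first by case: v0.
by case: tau_anis; exists v; split=> //; rewrite -[RHS]e /v /=; ring.
Qed.

(** Images in phi of the basis vectors y, x, z of l tau = l a [1, b] + l <1>. *)
Definition conic_vectors (phi : qform F) (l : F) (u0 u1 u2 : qspace phi) : Prop :=
  [/\ l != 0, phi u0 = a * b * l, phi u1 = a * l, phi u2 = l
    & [/\ polar phi u0 u1 = a * l, polar phi u0 u2 = 0 & polar phi u1 u2 = 0]].

Definition rank2 (phi : qform F) : Prop := exists f h : qspace phi -> F,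
  forall x y, polar phi x y = f x * h y + f y * h x.

Lemma rank2_radical phi x y r : rank2 phi -> polar phi x y != 0 ->
  polar phi r x = 0 -> polar phi r y = 0 -> radical r.
Proof.
move=> [f [h fh]]; rewrite !fh => D0 rx ry.
have fr0 : f r = 0.
  apply: (mulfI D0); rewrite mulr0.
  transitivity (f x * (f r * h y + f y * h r) + f y * (f r * h x + f x * h r)).
    by apply: (eq_char2 (z := - (f x * f y * h r)) two0); ring.
  by rewrite rx ry; ring.
have hr0 : h r = 0.
  apply: (mulfI D0); rewrite mulr0.
  transitivity (h x * (f r * h y + f y * h r) + h y * (f r * h x + f x * h r)).
    by apply: (eq_char2 (z := - (h x * h y * f r)) two0); ring.
  by rewrite rx ry; ring.
by move=> v; rewrite fh fr0 hr0; ring.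
Qed.

Lemma qscale_anis (phi : qform F) l : l != 0 -> anisotropic phi -> anisotropic (qscale l phi).
Proof.
move=> l0 anis [v [v0 /eqP]]; rewrite /= mulf_eq0 (negPf l0) => /eqP e.
by apply: anis; exists v.
Qed.

Lemma conic_vectors_dominated phi l u0 u1 u2 : conic_vectors (phi := phi) l u0 u1 u2 ->
  dominated (qscale l (tau_form a b)) phi.
Proof.
case=> l0 q0 q1 q2 [p01 p02 p12].
pose g (v : qspace (qscale l (tau_form a b))) := v.1.1 *: u1 + v.1.2 *: u0 + v.2 *: u2.
have gP : linear g.
  move=> c v w; transitivity ((c * v.1.1 + w.1.1) *: u1 + (c * v.1.2 + w.1.2) *: u0
    + (c * v.2 + w.2) *: u2); first by [].
  by rewrite /g !scalerDl -!scalerA !scalerDr [X in X + _]addrACA [LHS]addrACA.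
have gE v : qscale l (tau_form a b) v = phi (g v).
  rewrite /g !qformD !qformZ !polarDl !polarZl !polarZr q0 q1 q2 p02 p12.
  by rewrite (polarC u1) p01 /=; ring.
pose G := HB.pack_for {linear _ -> qspace phi} g
  (GRing.isLinear.Build F (qspace (qscale l (tau_form a b))) (qspace phi) _ g gP).
exists G; split=> //; apply: (@anisotropic_injective _ _ _ G) => //.
exact: qscale_anis.
Qed.

Lemma rank2_conic_radical phi l u0 u1 u2 : a != 0 -> rank2 phi ->
  conic_vectors (phi := phi) l u0 u1 u2 ->
  forall r, polar phi r u0 = 0 -> polar phi r u1 = 0 -> radical r.
Proof.
move=> a0 r2 [l0 _ _ _ [p01 _ _]] r; apply: rank2_radical => //.
by rewrite p01 mulf_neq0.
Qed.

(** The plane u1, u0 is a l [1, b] and u2 is orthogonal to it, hence radical with value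
    l.  The plane splits off phi, and the projection along it identifies the complement
    with the quasilinear part. *)
Lemma conic_vectors_subform phi rho l u0 u1 u2 : rank2 phi -> is_ql phi rho ->
  conic_vectors (phi := phi) l u0 u1 u2 ->
  [/\ a * l != 0, subform (qscale (a * l) (q2 1 b)) phi
    & prodset (represents (qscale a (q2 1 b))) (represents rho) (a * l)].
Proof.
move=> r2 ql cv; have a0 := a_neq0 anisotropic_conic.
have radP := rank2_conic_radical a0 r2 cv.
case: cv => l0 q0 q1 q2' [p01 p02 p12].
have al0 : a * l != 0 by rewrite mulf_neq0.
split=> //; last first.
  exists a, l; split=> //.
    by split=> //; exists ((1, 0) : F^o * F^o); rewrite /=; ring.
  apply/(represents_ql _ two0 ql); split=> //; exists u2; split=> //.
  by apply: radP; rewrite polarC.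
case: ql => [abs [cs [[f [fb fE]] _]]]; have [f' [fK f'K]] := linear_inverse fb.
pose X v := polar phi v u0 / (a * l); pose Y v := polar phi v u1 / (a * l).
pose pr v := v - (X v *: u1 + Y v *: u0).
have XP c v w : X (c *: v + w) = c * X v + X w.
  by rewrite /X polarDl polarZl; ring.
have YP c v w : Y (c *: v + w) = c * Y v + Y w.
  by rewrite /Y polarDl polarZl; ring.
have prP c v w : pr (c *: v + w) = c *: pr v + pr w.
  by rewrite /pr XP YP combine2.
have p00 : polar phi u0 u0 = 0 by rewrite polarxx two0 mul0r.
have p11 : polar phi u1 u1 = 0 by rewrite polarxx two0 mul0r.
have pr_rad v : radical (pr v).
  apply: radP; rewrite /pr -scaleN1r polarDl !polarZl polarDl !polarZl.
    by rewrite (polarC u1) p01 p00 /X; field; rewrite l0 a0.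
  by rewrite p01 p11 /Y; field; rewrite l0 a0.
pose g (v : qspace phi) : qspace (qorth (qscale (a * l) (q2 1 b)) (qdiag cs)) :=
  ((X v, Y v), (f (pr v)).2).
have gP : linear g.
  by move=> c v w; rewrite /g XP YP prP linearP.
exists (qdiag cs).
exists (HB.pack_for {linear qspace phi -> qspace (qorth (qscale (a * l) (q2 1 b)) (qdiag cs))} g
  (GRing.isLinear.Build F _ _ _ g gP)).
have frad r : radical r -> (f r).1 = 0.
  move=> rad; apply: qbin_nondegenerate => // w; have := rad (f' (w, 0)).
  rewrite (polar_isometry fE) f'K polar_qorth /=.
  by rewrite (@polar0r F (qdiag cs)) addr0.
have f'rad s : radical (f' (0, s)).
  move=> w; rewrite (polar_isometry fE) f'K polar_qorth /=.
  by rewrite (@polar0l F (qbin abs)) add0r polar_qdiag.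
split.
  exists (fun t => t.1.1 *: u1 + t.1.2 *: u0 + f' (0, t.2)) => [v|[[x y] s]] /=.
    have -> : ((0, (f (pr v)).2) : qspace (qorth (qbin abs) (qdiag cs))) = f (pr v).
      by rewrite -(frad _ (pr_rad v)); case: (f _).
    by rewrite fK /pr addrC subrK.
  set v := _ + f' _.
  have Xv : X v = x.
    by rewrite /X /v !polarDl !polarZl (polarC u1) p01 p00 f'rad; field; rewrite l0 a0.
  have Yv : Y v = y.
    by rewrite /Y /v !polarDl !polarZl p01 p11 f'rad; field; rewrite l0 a0.
  rewrite /g Xv Yv; congr (_, _).
  by rewrite /pr Xv Yv /v [_ + f' _]addrC addrK f'K.
move=> v; rewrite -{1}(subrK (X v *: u1 + Y v *: u0) v) -/(pr v) qformD pr_rad addr0.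
rewrite fE /= frad // (@qform0 F (qbin abs)) add0r addrC; congr (_ + _).
by rewrite qformD !qformZ polarZl polarZr (polarC u1) p01 q0 q1; ring.
Qed.

End ConicVectors.

(** * Isotropy over the function field *)

(** Linear functionals as columns, so that they extend to K. *)
Lemma functional_col (F : fieldType) (phi : qform F) (g : qspace phi -> F) : scalar g ->
  exists c : 'cV[F]_(qdim phi), forall v, (unvec v *m c) 0 0 = g v.
Proof.
move=> gP; pose G := HB.pack_for {linear qspace phi -> F^o} g
  (GRing.isLinear.Build F (qspace phi) F^o _ g gP).
exists (\col_i g (vbasis {: qspace phi})`_i) => v.
rewrite -[in RHS](unvecK v) /vec -[RHS]/(G _) linear_sum mxE; apply: eq_bigr => i _.
by rewrite linearZ /= !mxE.
Qed.

Section MatrixLinear.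
Variables (R : comNzRingType) (d : nat).
Implicit Types (A B : 'M[R]_d) (x : 'rV[R]_d).
Lemma mquad_addmx A B x : mquad (A + B) x = mquad A x + mquad B x.
Proof. by rewrite /mquad /mbil mulmxDr mulmxDl mxE. Qed.
Lemma mquad_scalemx c A x : mquad (c *: A) x = c * mquad A x.
Proof. by rewrite /mquad /mbil -scalemxAr -scalemxAl mxE. Qed.
Lemma mquad_mulcol (g h : 'cV[R]_d) x :
  mquad (g *m h^T) x = (x *m g) 0 0 * (x *m h) 0 0.
Proof.
rewrite /mquad /mbil mulmxA -mulmxA -trmx_mul [LHS]mxE big_ord1.
by rewrite [(_^T) 0 0]mxE.
Qed.
End MatrixLinear.

Section Components.
Variables (F : fieldType) (V : lmodType F).

Lemma qorth_components (A B : qform F) (g : {linear V -> qspace (qorth A B)}) :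
  exists (g1 : {linear V -> qspace A}) (g2 : {linear V -> qspace B}),
  forall v, qorth A B (g v) = A (g1 v) + B (g2 v).
Proof.
pose g1 v := (g v).1; pose g2 v := (g v).2.
have P1 : linear g1 by move=> k u v; rewrite /g1 linearP.
have P2 : linear g2 by move=> k u v; rewrite /g2 linearP.
exists (HB.pack_for {linear V -> qspace A} g1 (GRing.isLinear.Build F V (qspace A) _ g1 P1)).
by exists (HB.pack_for {linear V -> qspace B} g2 (GRing.isLinear.Build F V (qspace B) _ g2 P2)).
Qed.

Lemma q2_components (d b : F) (g : {linear V -> qspace (qscale d (q2 1 b))}) :
  exists x y : V -> F, [/\ scalar x, scalar y
    & forall v, qscale d (q2 1 b) (g v) = d * (x v * x v + x v * y v + b * (y v * y v))].
Proof.
exists (fun v => (g v).1), (fun v => (g v).2).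
by split=> [k u v|k u v|v]; rewrite ?linearP //=; ring.
Qed.
End Components.

Lemma qpfister2E (F : fieldType) (a b c : F) : qpfister [:: c; a] b =
  qorth (qscale (1 * (1 * 1)) (q2 1 b)) (qorth (qscale (1 * (a * 1)) (q2 1 b))
    (qorth (qscale (c * (1 * 1)) (q2 1 b)) (qorth (qscale (c * (a * 1)) (q2 1 b)) (q0 F)))).
Proof. by []. Qed.

Lemma pfister_components (F : fieldType) (a b c : F) (phi : qform F)
    (f : {linear qspace phi -> qspace (qpfister [:: c; a] b)}) :
  exists x1 y1 x2 y2 x3 y3 x4 y4 : 'cV[F]_(qdim phi),
  let e v (u : 'cV[F]_(qdim phi)) := (unvec v *m u) 0 0 in
  let n v x y := e v x * e v x + e v x * e v y + b * (e v y * e v y) in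
  forall v, qpfister [:: c; a] b (f v) =
    n v x1 y1 + a * n v x2 y2 + (c * n v x3 y3 + c * a * n v x4 y4).
Proof.
rewrite qpfister2E in f *.
have [g1 [h1 E1]] := qorth_components f; have [g2 [h2 E2]] := qorth_components h1.
have [g3 [h3 E3]] := qorth_components h2; have [g4 [h4 E4]] := qorth_components h3.
have [x1 [y1 [/functional_col[x1' X1] /functional_col[y1' Y1] Q1]]] := q2_components g1.
have [x2 [y2 [/functional_col[x2' X2] /functional_col[y2' Y2] Q2]]] := q2_components g2.
have [x3 [y3 [/functional_col[x3' X3] /functional_col[y3' Y3] Q3]]] := q2_components g3.
have [x4 [y4 [/functional_col[x4' X4] /functional_col[y4' Y4] Q4]]] := q2_components g4.
exists x1', y1', x2', y2', x3', y3', x4', y4' => e n v.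
rewrite E1 E2 E3 E4 Q1 Q2 Q3 Q4 -[q0 F _]/(0 : F) /n /e X1 Y1 X2 Y2 X3 Y3 X4 Y4.
ring.
Qed.

Section Conversely.
Variables (F : fieldType) (a b : F) (two0 : 2 = 0 :> F).

(** Write e = a N(z1, z2) l with l a value on the radical.  As N is multiplicative,
    e [1, b] is isometric to a l [1, b] through multiplication by (z1 + z2 rho) / n in
    F[rho], where rho^2 = rho - b and n = N(z1, z2). *)
Lemma subform_conic_vectors (phi rho : qform F) (e : F) : is_ql phi rho ->
  subform (qscale e (q2 1 b)) phi ->
  prodset (represents (qscale a (q2 1 b))) (represents rho) e ->
  exists l u0 u1 u2, conic_vectors a b (phi := phi) l u0 u1 u2.
Proof.
move=> ql [phi' [f [fb fE]]] [x [l [[x0 [[z1 z2] /= xE]] /(represents_ql _ two0 ql)]]].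
rewrite mul1r in xE => -[l0 [r [rad re]]] eE; have [f' [fK f'K]] := linear_inverse fb.
pose n := z1 ^+ 2 + z1 * z2 + b * z2 ^+ 2.
have n0 : n != 0 by apply: contraNneq x0 => n0; rewrite -xE -/n n0 mulr0.
have {}xE : x = a * n by [].
pose pl (u : F * F) := f' ((u : qspace (qscale e (q2 1 b))), 0).
have plE u : phi (pl u) = e * (u.1 ^+ 2 + u.1 * u.2 + b * u.2 ^+ 2).
  by rewrite /pl fE f'K /= (@qform0 F phi') addr0 mul1r.
have plB u v : polar phi (pl u) (pl v) = polar (qscale e (q2 1 b)) u v.
  by rewrite (polar_isometry fE) !f'K polar_qorth /= (@polar0l F phi') addr0.
exists l, (pl (- b * z2 / n, (z1 + z2) / n)), (pl (z1 / n, z2 / n)), r; split=> //.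
- by rewrite plE eE xE /n /=; field.
- by rewrite plE eE xE /n /=; field.
split; last 2 first.
- by rewrite polarC rad.
- by rewrite polarC rad.
by rewrite plB eE xE /polar /= /n; field.
Qed.

Variables (K : fieldType) (iota : {rmorphism F -> K}) (X0 Y0 Z0 : K).
Hypothesis Z0n0 : Z0 != 0.
Hypothesis conicK : iota a * (X0 ^+ 2 + X0 * Y0 + iota b * Y0 ^+ 2) + Z0 ^+ 2 = 0.

Lemma tau_ext_isotropic l : isotropic (qext iota (qscale l (tau_form a b))).
Proof.
set psi := qscale l (tau_form a b); apply/isotropic_qext.
pose t0 : qspace psi := ((1, 0), 0); pose t1 : qspace psi := ((0, 1), 0).
pose t2 : qspace psi := ((0, 0), 1).
pose u t : 'rV[K]_(qdim psi) := map_mx iota (unvec t).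
exists (X0 *: u t0 + Y0 *: u t1 + Z0 *: u t2); split; last first.
  rewrite !mpolE /u !mquad_map !mpol_map !mquad_gram !mpol_gram !unvecK.
  transitivity (iota l * (iota a * (X0 ^+ 2 + X0 * Y0 + iota b * Y0 ^+ 2) + Z0 ^+ 2)).
    rewrite /polar /= !(rmorphD, rmorphN, rmorphM, rmorph1, rmorph0, rmorphXn) /=; ring.
  by rewrite conicK mulr0.
have [|c cE] := @functional_col F psi (fun t => t.2) => //.
apply: contraNneq Z0n0 => e0.
have : ((X0 *: u t0 + Y0 *: u t1 + Z0 *: u t2) *m map_mx iota c) 0 0 = 0.
  by rewrite e0 mul0mx mxE.
have uc t : (u t *m map_mx iota c) 0 0 = iota t.2.
  by rewrite /u -map_mxM mxE cE.
rewrite !mulmxDl -!scalemxAl.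
rewrite 2![(_ + _ : 'M_(_, _)) 0 0]mxE 3![(_ *: _ : 'M_(_, _)) 0 0]mxE !uc /t0 /t1 /t2 /=.
by rewrite rmorph0 rmorph1 !mulr0 !add0r mulr1 => /eqP.
Qed.

(** Over K, the conic point (X0, Y0, Z0) gives a totally isotropic plane in
    N(p, q) + a N(p', q'): the pairs with Z0 (p + q rho) = a (X0 + Y0 rho)(p' + q' rho),
    rho^2 = rho - b.  Two copies give a 4-dimensional totally isotropic subspace of the
    Pfister form, cut out by 4 linear equations, and more than 4 unknowns leave a
    nonzero solution in phi. *)
Lemma pfister_ext_isotropic (phi : qform F) (alpha c : F) : alpha != 0 ->
  dominated (qscale alpha phi) (qpfister [:: c; a] b) -> (4 < qdim phi)%N ->
  isotropic (qext iota phi).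
Proof.
move=> alpha0 [f [_ fE]] d5; apply/isotropic_qext.
set d := qdim phi in d5 *.
have [x1 [y1 [x2 [y2 [x3 [y3 [x4 [y4 fE']]]]]]]] := pfister_components f.
pose nm (x y : 'cV[F]_d) := x *m x^T + x *m y^T + b *: (y *m y^T).
pose N := alpha *: gram phi + (-1) *: (nm x1 y1 + a *: nm x2 y2 + c *: nm x3 y3
  + (c * a) *: nm x4 y4).
have NE := (mquad_addmx, mquad_scalemx, mquad_mulcol).
have N0 x : mquad N x = 0.
  rewrite -(vecK x); set v := vec x.
  rewrite /N /nm !NE mquad_gram unvecK.
  rewrite -[alpha * phi v]/(qscale alpha phi v) fE fE' /=; ring.
pose sol := row_mx (row_mx
  (Z0 *: map_mx iota x1 - iota a *: (X0 *: map_mx iota x2 - (iota b * Y0) *: map_mx iota y2))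
  (Z0 *: map_mx iota y1 - iota a *: (X0 *: map_mx iota y2 + Y0 *: map_mx iota x2
    + Y0 *: map_mx iota y2)))
  (row_mx
  (Z0 *: map_mx iota x3 - iota a *: (X0 *: map_mx iota x4 - (iota b * Y0) *: map_mx iota y4))
  (Z0 *: map_mx iota y3 - iota a *: (X0 *: map_mx iota y4 + Y0 *: map_mx iota x4
    + Y0 *: map_mx iota y4))).
have /rowV0Pn[x /sub_kermxP xsol x0] : kermx sol != 0.
  rewrite -mxrank_eq0 mxrank_ker -lt0n subn_gt0.
  by rewrite (leq_ltn_trans (rank_leq_col _)).
exists x; split=> //.
move: xsol; rewrite !mul_mx_row => /eqP.
rewrite !(row_mx_eq0, andbA) => /andP[/andP[/andP[/eqP e1 /eqP e2] /eqP e3] /eqP e4].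
pose L (u : 'cV[K]_d) := (x *m u) 0 0.
have LB u v : L (u - v) = L u - L v by rewrite /L mulmxBr [LHS]mxE [X in _ + X]mxE.
have LD u v : L (u + v) = L u + L v by rewrite /L mulmxDr [LHS]mxE.
have LZ k u : L (k *: u) = k * L u by rewrite /L -scalemxAr [LHS]mxE.
have L0 u : x *m u = 0 -> L u = 0 by rewrite /L => ->; rewrite mxE.
move/L0: e1; move/L0: e2; move/L0: e3; move/L0: e4.
rewrite !(LB, LD, LZ).
set p1 := L (map_mx iota x1); set q1 := L (map_mx iota y1).
set p2 := L (map_mx iota x2); set q2 := L (map_mx iota y2).
set p3 := L (map_mx iota x3); set q3 := L (map_mx iota y3).
set p4 := L (map_mx iota x4); set q4 := L (map_mx iota y4) => e4 e3 e2 e1.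
have := mquad_ext iota N0 x; rewrite /N /nm.
rewrite !(map_mxD, map_mxZ, map_mxM) /= -!map_trmx !NE -!/(L _).
rewrite -/p1 -/q1 -/p2 -/q2 -/p3 -/q3 -/p4 -/q4 !(rmorphM, rmorphN, rmorph1) => eN.
(* a solution of the first two equations is isotropic for the first two summands *)
have half (p q p' q' : K) :
    Z0 * p - iota a * (X0 * p' - iota b * Y0 * q') = 0 ->
    Z0 * q - iota a * (X0 * q' + Y0 * p' + Y0 * q') = 0 ->
    p * p + p * q + iota b * (q * q) + iota a * (p' * p' + p' * q' + iota b * (q' * q')) = 0.
  move=> /eqP; rewrite subr_eq0 => /eqP ep /eqP; rewrite subr_eq0 => /eqP eq.
  have Z2 : Z0 ^+ 2 != 0 by rewrite expf_neq0.
  apply: (mulfI Z2); rewrite mulr0.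
  transitivity ((Z0 * p) ^+ 2 + (Z0 * p) * (Z0 * q) + iota b * (Z0 * q) ^+ 2
     + Z0 ^+ 2 * (iota a * (p' * p' + p' * q' + iota b * (q' * q')))); first by ring.
  have Z2E : Z0 ^+ 2 = - (iota a * (X0 ^+ 2 + X0 * Y0 + iota b * Y0 ^+ 2)).
    by apply/eqP; rewrite -addr_eq0 addrC conicK.
  by rewrite Z2E ep eq; ring.
have ia0 : iota alpha != 0 by rewrite fmorph_eq0.
apply: (mulfI ia0); rewrite mulr0.
have h1 := half _ _ _ _ e1 e2; have h2 := half _ _ _ _ e3 e4.
set Q := mquad _ x in eN *; move: eN; rewrite -/Q => eN.
transitivity (iota alpha * Q + -1 * ((p1 * p1 + p1 * q1 + iota b * (q1 * q1)
    + iota a * (p2 * p2 + p2 * q2 + iota b * (q2 * q2)))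
  + iota c * (p3 * p3 + p3 * q3 + iota b * (q3 * q3)
    + iota a * (p4 * p4 + p4 * q4 + iota b * (q4 * q4))))).
  by rewrite h1 h2; ring.
by rewrite -[RHS]eN; ring.
Qed.

End Conversely.

(** * Embedding into a Pfister form *)

Section Embedding.
Variables (F : fieldType) (V : lmodType F).

Lemma qorth_pair (A B : qform F) (g : {linear V -> qspace A}) (h : {linear V -> qspace B}) :
  exists f : {linear V -> qspace (qorth A B)},
  forall v, qorth A B (f v) = A (g v) + B (h v).
Proof.
pose f v : qspace (qorth A B) := (g v, h v).
have fP : linear f by move=> k u v; rewrite /f !linearP.
by exists (HB.pack_for {linear V -> qspace (qorth A B)} f
  (GRing.isLinear.Build F V (qspace (qorth A B)) _ f fP)).
Qed.

Lemma q2_pair (d b : F) (x y : V -> F) : scalar x -> scalar y ->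
  exists f : {linear V -> qspace (qscale d (q2 1 b))},
  forall v, qscale d (q2 1 b) (f v) = d * (x v * x v + x v * y v + b * (y v * y v)).
Proof.
move=> xP yP; pose f v : qspace (qscale d (q2 1 b)) := (x v, y v).
have fP : linear f by move=> k u v; rewrite /f xP yP.
exists (HB.pack_for {linear V -> qspace (qscale d (q2 1 b))} f
  (GRing.isLinear.Build F V (qspace (qscale d (q2 1 b))) _ f fP)) => v /=; ring.
Qed.

Lemma q0_map : exists f : {linear V -> qspace (q0 F)}, forall v, q0 F (f v) = 0.
Proof.
have fP : linear (fun _ : V => 0 : qspace (q0 F)).
  by move=> k u v; rewrite scaler0 addr0.
by exists (HB.pack_for {linear V -> qspace (q0 F)} (fun _ : V => 0 : qspace (q0 F))
  (GRing.isLinear.Build F V (qspace (q0 F)) _ (fun _ : V => 0 : qspace (q0 F)) fP)).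
Qed.

Lemma pfister_map (a b c : F) (x1 y1 x2 y2 x3 y3 x4 y4 : V -> F) :
  [/\ scalar x1, scalar y1, scalar x2 & scalar y2] ->
  [/\ scalar x3, scalar y3, scalar x4 & scalar y4] ->
  exists f : {linear V -> qspace (qpfister [:: c; a] b)},
  let n v x y := x v * x v + x v * y v + b * (y v * y v) in
  forall v, qpfister [:: c; a] b (f v) =
    n v x1 y1 + a * n v x2 y2 + (c * n v x3 y3 + c * a * n v x4 y4).
Proof.
move=> [X1 Y1 X2 Y2] [X3 Y3 X4 Y4]; rewrite qpfister2E.
have [g1 E1] := q2_pair (1 * (1 * 1)) b X1 Y1.
have [g2 E2] := q2_pair (1 * (a * 1)) b X2 Y2.
have [g3 E3] := q2_pair (c * (1 * 1)) b X3 Y3.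
have [g4 E4] := q2_pair (c * (a * 1)) b X4 Y4.
have [h0 H0] := q0_map.
have [h4 H4] := qorth_pair g4 h0; have [h3 H3] := qorth_pair g3 h4.
have [h2 H2] := qorth_pair g2 h3; have [h1 H1] := qorth_pair g1 h2.
exists h1 => n v; rewrite H1 H2 H3 H4 H0 E1 E2 E3 E4 /n; ring.
Qed.
End Embedding.

Lemma qdim_qorth (F : fieldType) (p q : qform F) : qdim (qorth p q) = (qdim p + qdim q)%N.
Proof. by rewrite /qdim !dimvf. Qed.

Lemma qdim_qpfister2 (F : fieldType) (a b c : F) : qdim (qpfister [:: c; a] b) = 8%N.
Proof.
have d2 d : qdim (qscale d (q2 1 b)) = 2%N by rewrite /qdim dimvf.
have d0 : qdim (q0 F) = 0%N by rewrite /qdim dimvf.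
by rewrite qpfister2E !qdim_qorth !d2 d0.
Qed.

Section PfisterNeighbor.
Variables (F : fieldType) (a b : F) (two0 : 2 = 0 :> F).
Hypothesis conic_anis : forall x y z : F,
  a * (x ^+ 2 + x * y + b * y ^+ 2) + z ^+ 2 = 0 -> [/\ x = 0, y = 0 & z = 0].
Variable phi : qform F.
Hypothesis phi_anis : anisotropic phi.
Hypothesis phi_rank2 : rank2 phi.
Hypothesis phi_dim : qdim phi = 5%N.

Lemma gram_anis (x : 'rV[F]_(qdim phi)) : mquad (gram phi) x = 0 -> x = 0.
Proof.
move=> q0; apply/eqP/negPn/negP => x0; apply: phi_anis.
by apply/isotropic_mquad; exists x.
Qed.

(** View <<s, a, b]] as E + a E + s E + s a E with the norm of E = F[rho],
    rho^2 = rho + b, and take s = N(l, 1) + a m.  The five basis vectors go to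
    (0, (rho + 1)(l + rho) / a, 0, rho / a), (0, (l + rho) / a, 0, 1 / a), (l, 0, 1, 0),
    (1, 0, 0, 0) and (0, 1, 0, 0): since m = (N(l, 1) + s) / a, the second has value m,
    the first is rho times it up to conjugation, and the remaining polar values are
    traces.  Anisotropy makes the isometric map injective. *)
Lemma degree2_pfister : isotropic_in_degree2 a b (gram phi) ->
  exists2 s, s != 0 & exists2 alpha, alpha != 0
    & dominated (qscale alpha phi) (qpfister [:: s; a] b).
Proof.
have a0 := a_neq0 conic_anis; have [f [h fh]] := phi_rank2.
have rk x y : mpol (gram phi) x y = f (vec x) * h (vec y) + f (vec y) * h (vec x).
  by rewrite mpol_gram fh.
move/(degree2_normal_form two0 conic_anis gram_anis rk).
move=> [v0 [v1 [v2 [v3 [v4 [p [l [m [fr p0 s0 qE]]]]]]]]].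
pose s := l ^+ 2 + l + b + a * m.
pose C := \matrix_(k < 5) nth 0 [:: v0; v1; v2; v3; v4] k.
have Cfree : row_free C by apply/free5P.
have /row_fullP[D DC] : row_full C.
  by rewrite /row_full (eqP Cfree) phi_dim.
pose y v := unvec v *m D.
have yv v : unvec v = y v 0 0 *: v0 + y v 0 1 *: v1 + y v 0 2 *: v2 + y v 0 3 *: v3
    + y v 0 4 *: v4.
  by rewrite -[LHS]mulmx1 -DC mulmxA mulmx_rows5.
have yP k c u v : y (c *: u + v) 0 k = c * y u 0 k + y v 0 k.
  by rewrite /y linearP mulmxDl -scalemxAl !mxE.
have [||g gE] := @pfister_map F (qspace phi) a b s
  (fun v => y v 0 3 + l * y v 0 2) (fun=> 0)
  (fun v => ((l + b) * y v 0 0 + l * y v 0 1 + a * y v 0 4) / a)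
  (fun v => (l * y v 0 0 + y v 0 1) / a)
  (fun v => y v 0 2) (fun=> 0) (fun v => y v 0 1 / a) (fun v => y v 0 0 / a).
- by split=> c u v; rewrite ?yP; ring.
- by split=> c u v; rewrite ?yP; ring.
exists s => //; exists p^-1; first by rewrite invr_neq0.
have gq (v : qspace phi) : qscale p^-1 phi v = qpfister [:: s; a] b (g v).
  transitivity (p^-1 * mquad (gram phi) (unvec v)); first by rewrite mquad_gram unvecK.
  rewrite gE {1}yv qE mulKf //=.
  move: (y v 0 0) (y v 0 1) (y v 0 2) (y v 0 3) (y v 0 4) => y0 y1 y2 y3 y4.
  apply/esym; apply: (eq_char2 (z := (a * b * y0 * y4 + a * l * y0 * y4 + a * l * y1 * y4
    + a * l * y2 * y3 + a * l ^+ 2 * y2 ^+ 2 + 2 * b * l * y0 * y1 + 2 * b * l * y0 ^+ 2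
    + b * l ^+ 2 * y0 ^+ 2 + b * y0 * y1 + b * y1 ^+ 2 + b ^+ 2 * y0 ^+ 2 + l * y0 * y1
    + l * y1 ^+ 2 + 2 * l ^+ 2 * y0 * y1 + l ^+ 2 * y0 ^+ 2 + l ^+ 2 * y1 ^+ 2) / a) two0).
  by rewrite /s; field.
exists g; split=> //; apply: (@anisotropic_injective F (qscale p^-1 phi) _ g) => //.
by apply: qscale_anis => //; rewrite invr_neq0.
Qed.
End PfisterNeighbor.

(** * The alternative for forms of dimension at most five *)

Section IsotropyAlternative.
Variables (F : fieldType) (a b : F) (two0 : 2 = 0 :> F).
Hypothesis tau_anis : anisotropic (tau_form a b).

Lemma isotropic_cases (K : fieldType) (iota : {rmorphism F -> K}) (phi : qform F) :
  is_quotient_field (tau_poly a b) iota -> anisotropic phi -> (qdim phi <= 5)%N ->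
  isotropic (qext iota phi) ->
  (exists l u0 u1 u2, conic_vectors a b (phi := phi) l u0 u1 u2) \/
  isotropic_in_degree2 a b (gram phi).
Proof.
move=> [ev [evC evker evfrac]] anis d5 /isotropic_qext[x [x0 qx]].
have [v [v0 qv]] := isotropic_over_ring evC evker evfrac x0 qx.
pose n := (\max_i qdeg (v 0%R i))%N.
have vn i : (qdeg (v 0%R i) <= n)%N by apply: (leq_bigmax_cond (F := fun i => qdeg (v 0%R i))).
have [[u0 [u1 [u2 [[e0 e1 e01 e02 e12] q2]]]]|] :=
  isotropic_deg_le (anisotropic_conic tau_anis) (gram_anis anis) d5 v0 qv vn; last by right.
left; exists (phi (vec u2)), (vec u0), (vec u1), (vec u2).
by rewrite /conic_vectors -!mquad_gram -!mpol_gram.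
Qed.

(** Five independent coefficient vectors need dimension 5. *)
Lemma isotropic_cases_lt5 (K : fieldType) (iota : {rmorphism F -> K}) (phi : qform F) :
  is_quotient_field (tau_poly a b) iota -> anisotropic phi -> (qdim phi < 5)%N ->
  isotropic (qext iota phi) ->
  exists l u0 u1 u2, conic_vectors a b (phi := phi) l u0 u1 u2.
Proof.
move=> Kff anis d5 /(isotropic_cases Kff anis (ltnW d5))[//|[w [/eqP wfree _]]].
by have := rank_leq_col (\matrix_k w k); rewrite wfree leqNgt d5.
Qed.

Lemma conic_vectors_dom (psi phi : qform F) l u0 u1 u2 : dominated psi phi ->
  conic_vectors a b (phi := psi) l u0 u1 u2 ->
  exists w0 w1 w2, conic_vectors a b (phi := phi) l w0 w1 w2.
Proof.
move=> [f [_ fE]] [l0 q0 q1 q2 [p01 p02 p12]]; exists (f u0), (f u1), (f u2).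
by rewrite /conic_vectors -!fE -!(polar_isometry fE).
Qed.

Lemma type13_rank2 (phi : qform F) : of_type 1 3 phi -> rank2 phi.
Proof.
move=> [abs [cs [f [_ fE]]]].
have [p [q pq]] : rank2 (qbin abs).
  case: abs {f fE} => -[|[a1 b1] [|//]] //= _.
  exists (fun v => v.1.1), (fun v => v.1.2) => x y.
  rewrite (polar_qorth (phi := q2 a1 b1) (psi := q0 F)) polar_q2 //.
  by rewrite [polar (q0 F) _ _]/polar /= !subr0 addr0; ring.
exists (fun v => p (f v).1), (fun v => q (f v).1) => x y.
by rewrite (polar_isometry fE) polar_qorth polar_qdiag // addr0.
Qed.

Lemma type13_dim (phi : qform F) : of_type 1 3 phi -> qdim phi = 5%N.
Proof.
move=> [abs [cs [f [fb fE]]]]; rewrite (bijective_qdim fb) qdim_qorth.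
case: abs {f fb fE} => -[|[a1 b1] [|//]] //= _.
case: cs => -[|c1 [|c2 [|c3 [|//]]]] //= _.
have d1 c : qdim (q1 c) = 1%N by rewrite /qdim dimvf.
have d2 : qdim (q2 a1 b1) = 2%N by rewrite /qdim dimvf.
have d0 : qdim (q0 F) = 0%N by rewrite /qdim dimvf.
by rewrite -[qbin _]/(qorth (q2 a1 b1) (q0 F))
  -[qdiag _]/(qorth (q1 c1) (qorth (q1 c2) (qorth (q1 c3) (q0 F)))) !qdim_qorth !d1 d2 d0.
Qed.

Lemma dominated_trans (p q r : qform F) : dominated p q -> dominated q r -> dominated p r.
Proof.
move=> [f [fI fE]] [g [gI gE]]; exists (g \o f); split; first exact: inj_comp.
by move=> v; rewrite fE gE.
Qed.

Lemma isometric_dominated (p q : qform F) : isometric p q -> dominated p q.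
Proof. by move=> [f [fb fE]]; exists f; split=> //; apply: bij_inj. Qed.

End IsotropyAlternative.

(** * Minimality over the function field of a conic *)

Theorem theorem4 (F : fieldType) (char2 : 2%N \in [pchar F])
    (phi qlphi : qform F) (a b : F)
    (phi_anis : anisotropic phi) (phi_type : of_type 1 3 phi)
    (phi_ql : is_ql phi qlphi)
    (tau_anis : anisotropic (tau_form a b))
    (tau_dim : qdim (tau_form a b) = 3%N)
    (tau_type : of_type 1 1 (tau_form a b))
    (Ftau : fieldType) (iota : {rmorphism F -> Ftau})
    (Ftau_ff : is_quotient_field (tau_poly a b) iota) :
  minimal iota phi <->
  (exists pi : qform F,
      [/\ is_qpfister 3 pi /\ pfister_neighbor phi pi,
          exists c : F, c != 0 /\ isometric pi (qpfister [:: c; a] b) &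
          forall e : F, e != 0 -> subform (qscale e (q2 1 b)) phi ->
            ~ prodset (represents (qscale a (q2 1 b))) (represents qlphi) e]).
Proof.
have two0 : 2 = 0 :> F by apply: pcharf0.
have phi_dim := type13_dim phi_type.
have phi_rank2 := type13_rank2 two0 phi_type.
have [ev [evC evker _]] := Ftau_ff.
have Z0 := ev_X2 evker.
have conicK := ev_conic evC evker.
have a0 := a_neq0 (anisotropic_conic tau_anis).
split=> [[_ phiK phi_min]|[pi [[_ [[alpha [alpha0 phi_pi]] _]] [c [c0 pi_abc]] no_conic]]].
  have no_conic l u0 u1 u2 : ~ conic_vectors a b (phi := phi) l u0 u1 u2.
    move=> cv; apply: (phi_min (qscale l (tau_form a b))).
    - exact: conic_vectors_dominated cv.
    - by rewrite phi_dim; apply: leq_ltn_trans (eq_leq tau_dim) _.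
    exact (tau_ext_isotropic Z0 conicK l).
  have [|s s0 [alpha alpha0 dom]] :=
      degree2_pfister two0 (anisotropic_conic tau_anis) phi_anis phi_rank2 phi_dim.
    have [[l [u0 [u1 [u2 /no_conic //]]]]|//] :=
      isotropic_cases tau_anis Ftau_ff phi_anis (eq_leq phi_dim) phiK.
  exists (qpfister [:: s; a] b); split.
  - split; first by exists [:: s; a], b; split; [by []|by rewrite /= s0 a0|exact: isometric_refl].
    by split; [exists alpha | rewrite qdim_qpfister2 phi_dim].
  - by exists s; split=> //; apply: isometric_refl.
  move=> e _ sub prd.
  by have [l [u0 [u1 [u2 /no_conic]]]] := subform_conic_vectors two0 phi_ql sub prd.
have dom : dominated (qscale alpha phi) (qpfister [:: c; a] b).
  exact: dominated_trans phi_pi (isometric_dominated pi_abc).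
split=> //.
  have d5 : (4 < qdim phi)%N by rewrite phi_dim.
  exact (pfister_ext_isotropic Z0 conicK alpha0 dom d5).
move=> psi psi_phi psi_dim psiK; rewrite phi_dim in psi_dim.
have psi_anis : anisotropic psi.
  move: psi_phi => [f [fI fE]] [v [v0 qv]]; apply: phi_anis; exists (f v).
  rewrite -fE qv; split=> //; apply: contraNneq v0 => fv0; apply/eqP.
  by apply: fI; rewrite fv0 linear0.
have [l [u0 [u1 [u2 cv]]]] := isotropic_cases_lt5 tau_anis Ftau_ff psi_anis psi_dim psiK.
have [w0 [w1 [w2 cw]]] := conic_vectors_dom psi_phi cv.
have [al0 sub prd] := conic_vectors_subform two0 tau_anis phi_rank2 phi_ql cw.
exact: no_conic al0 sub prd.
Qed.
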